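(* Let $\mathcal{H}$ be a complex Hilbert space and let $[0,+\infty[\,\ni t\mapsto S(t)\in\mathcal{L}(\mathcal{H},\mathcal{H})$ be a strongly continuous semigroup with $S(0)=I$ and generator $A$. Let $\omega\in\mathbb{R}$ and assume that $\|(z-A)^{-1}\|$ is uniformly bounded in the half-plane $\{z\in\mathbb{C}:\operatorname{Re} z\ge\omega\}$ (in particular this half-plane is contained in the resolvent set of $A$). Define $r(\omega)>0$ by $$\frac{1}{r(\omega)}=\sup_{\operatorname{Re} z\ge\omega}\|(z-A)^{-1}\|.$$ Let $m:[0,+\infty[\to\,]0,+\infty[$ be a continuous positive function with $m(t)\ge\|S(t)\|$ for all $t\ge 0$. Then for all $t,a,\widetilde a>0$ such that $t=a+\widetilde a$, $$\|S(t)\|\le\frac{e^{\omega t}}{r(\omega)\,\left\|\frac1m\right\|_{e^{-\omega\cdot}L^2([0,a])}\,\left\|\frac1m\right\|_{e^{-\omega\cdot}L^2([0,\widetilde a])}}.$$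
   Context: $\|S(t)\|$ and $\|(z-A)^{-1}\|$ denote operator norms in $\mathcal{L}(\mathcal{H},\mathcal{H})$. For $\omega\in\mathbb{R}$, $b>0$ and a function $f$ on $[0,b]$, the exponentially weighted norm is $$\|f\|_{e^{-\omega\cdot}L^2([0,b])}=\|e^{\omega\cdot}f(\cdot)\|_{L^2([0,b])}=\left(\int_0^b e^{2\omega s}|f(s)|^2\,ds\right)^{1/2}.$$ *)

(* Defs.v *)
From Stdlib Require Import Reals.
From Coquelicot Require Import Coquelicot.

Open Scope R_scope.

(* The inner product is linear in the first argument. *)
Record HilbertSpace : Type := {
  hilbert_carrier :> CompleteNormedModule C_AbsRing;
  inner : hilbert_carrier -> hilbert_carrier -> C;
  inner_plus_l : forall x y z : hilbert_carrier,
    inner (plus x y) z = Cplus (inner x z) (inner y z);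
  inner_scal_l : forall (c : C) (x y : hilbert_carrier),
    inner (scal c x) y = Cmult c (inner x y);
  inner_conj : forall x y : hilbert_carrier, inner y x = Cconj (inner x y);
  (* Coquelicot only asks [norm] to be compatible with the uniform structure;
     this makes it the Hilbert norm. *)
  inner_norm : forall x : hilbert_carrier, inner x x = RtoC (norm x ^ 2)
}.

(* Finite, and equal to the usual norm, when [is_linear T], which in Coquelicot
   includes boundedness. *)
Definition op_norm {H : HilbertSpace} (T : H -> H) : R :=
  real (Lub_Rbar (fun y : R => exists x : H, norm x <= 1 /\ y = norm (T x))).

(* Only the values at times [0 <= t] are meaningful. *)
Record is_C0_semigroup {H : HilbertSpace} (S : R -> H -> H) : Prop := {
  semigroup_bounded : forall t : R, 0 <= t -> is_linear (S t);
  semigroup_0 : forall x : H, S 0 x = x;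
  semigroup_plus : forall (s t : R) (x : H),
    0 <= s -> 0 <= t -> S (s + t) x = S s (S t x);
  semigroup_cont : forall x : H,
    continuous_on (fun t : R => 0 <= t) (fun t : R => S t x)
}.

(* A possibly unbounded operator; the values of [op_app] outside [op_dom] are
   irrelevant. *)
Record operator (H : HilbertSpace) : Type := {
  op_dom : H -> Prop;
  op_app : H -> H
}.
Arguments op_dom {H} _ _.
Arguments op_app {H} _ _.

Definition diff_quotient_lim {H : HilbertSpace} (S : R -> H -> H) (x y : H) : Prop :=
  filterlim (fun h : R => scal (RtoC (/ h)) (minus (S h x) x))
            (at_right 0) (locally y).

Definition is_generator {H : HilbertSpace} (S : R -> H -> H) (A : operator H) : Prop :=
  (forall x : H, op_dom A x <-> exists y : H, diff_quotient_lim S x y) /\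
  (forall x : H, op_dom A x -> diff_quotient_lim S x (op_app A x)).

(* [T = (z - A)^{-1}]: a bounded two-sided inverse of [z - A : D(A) -> H]. *)
Definition is_resolvent {H : HilbertSpace} (A : operator H) (z : C) (T : H -> H) : Prop :=
  is_linear T /\
  (forall y : H, op_dom A (T y) /\ minus (scal z (T y)) (op_app A (T y)) = y) /\
  (forall x : H, op_dom A x -> T (minus (scal z x) (op_app A x)) = x).

Definition resolvent_bounded_on_half_plane {H : HilbertSpace}
    (A : operator H) (omega : R) : Prop :=
  exists M : R, forall z : C, omega <= Re z ->
    exists T : H -> H, is_resolvent A z T /\ op_norm T <= M.

Definition resolvent_norms {H : HilbertSpace} (A : operator H) (omega : R) (y : R) : Prop :=
  exists (z : C) (T : H -> H),
    omega <= Re z /\ is_resolvent A z T /\ y = op_norm T.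

(* Riemann integral: to be used for [f] continuous on [[0, b]]. *)
Definition weighted_L2_norm (omega b : R) (f : R -> R) : R :=
  sqrt (RInt (fun s : R => exp (2 * omega * s) * Rabs (f s) ^ 2) 0 b).

(* Main.v *)
Require Import Defs.
From Stdlib Require Import Reals Lra Lia List.
From Coquelicot Require Import Coquelicot.

(** Write |.| for the norm of H and g(s) = exp(-2 omega s) |S(s) u|^2 for u in the
    domain of the generator. The theorem rests on the tail estimate

      r^2 * int_a^t g  <=  int_0^a f^2 g       whenever  int_0^a f = 1.

    Granting it, take f proportional to exp(2 omega s) / m(s)^2, the choice that
    minimizes the right-hand side once |S(s) u| is replaced by m(s) |u|; the
    right-hand side becomes |u|^2 divided by the squared weighted norm of 1/m on
    [0,a]. On the left, |S(t) u| <= m(t-s) |S(s) u| bounds the integrand from below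
    by exp(-2 omega t) |S(t) u|^2 exp(2 omega (t-s)) / m(t-s)^2, which integrates to
    the squared weighted norm of 1/m on [0,a']. This gives the bound on the domain
    (orbit_bound_on_domain), and density of the domain extends it to H.

    The tail estimate is usually read off from Plancherel's theorem for
    phi(s) exp(-omega s) S(s) u, with phi the primitive of f. Here Plancherel is
    replaced by an exact finite analogue. For a sequence x in the domain of an
    operator B with x_N = x_0, the implicit Euler defects
    (x_{j+1} - x_j)/h - B x_{j+1} satisfy

      r^2 * sum |x_{j+1}|^2  <=  sum |defect_j|^2

    as soon as r |x| <= |z x - B x| for Re z >= 0. Indeed the discrete symbol
    (1 - e^{-i alpha})/h of the derivative lies in that half-plane, and for N a power of 2
    the diagonalization of the shift amounts to repeated use of the parallelogram law
    (quasi_periodic_euler_bound). Sampling phi(s) exp(-omega s) S(s) u with step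
    h -> 0 turns this into an inequality between integrals, for every compactly
    supported phi (energy_inequality); the defect of the sampled orbit is governed by
    a single difference quotient at time 0, so no convergence theory for the Euler
    scheme is involved.

    It remains to pass from compactly supported phi to a phi that stays equal to 1.
    Letting phi fall linearly from 1 to 0 on [T, T + 1/r] shows that the excess
    r^2 * int_a^T g - int_0^a f^2 g at least doubles when T grows by 1/r (window_estimate).
    Hence it is never positive, provided int_a^T g = O(e^{rT/2})
    (tail_energy_bound). This growth condition holds for large omega because the
    semigroup is exponentially bounded, and the tail estimate at one exponent yields
    the growth condition at the exponent smaller by r/4, so finitely many steps lead
    down to omega (slow_energy_growth_at_abscissa). *)

(** * Hilbert space identities *)

Lemma norm_sqr_inner (H : HilbertSpace) (x : H) : norm x ^ 2 = fst (inner H x x).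
Proof. rewrite inner_norm. reflexivity. Qed.

Lemma inner_plus_r (H : HilbertSpace) (x y z : H) :
  inner H x (plus y z) = Cplus (inner H x y) (inner H x z).
Proof.
  rewrite (inner_conj H (plus y z) x), inner_plus_l, (inner_conj H x y), (inner_conj H x z).
  unfold Cconj, Cplus; simpl; f_equal; ring.
Qed.

Lemma inner_scal_r (H : HilbertSpace) (c : C) (x y : H) :
  inner H x (scal c y) = Cmult (Cconj c) (inner H x y).
Proof.
  rewrite (inner_conj H (scal c y) x), inner_scal_l, (inner_conj H x y).
  unfold Cconj, Cmult; simpl; f_equal; ring.
Qed.

Lemma norm_scal_sqr (H : HilbertSpace) (c : C) (x : H) :
  norm (scal c x) ^ 2 = Cmod c ^ 2 * norm x ^ 2.
Proof.
  assert (Hc : Cmod c ^ 2 = fst c ^ 2 + snd c ^ 2).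
  { unfold Cmod. rewrite pow2_sqrt; [reflexivity|].
    apply Rplus_le_le_0_compat; apply pow2_ge_0. }
  rewrite norm_sqr_inner, inner_scal_l, inner_scal_r, inner_norm, Hc.
  unfold Cconj, Cmult, RtoC; simpl; ring.
Qed.

Lemma norm_scal_eq (H : HilbertSpace) (c : C) (x : H) :
  norm (scal c x) = Cmod c * norm x.
Proof.
  apply Rsqr_inj.
  - apply norm_ge_0.
  - apply Rmult_le_pos; [apply Cmod_ge_0 | apply norm_ge_0].
  - rewrite !Rsqr_pow2, norm_scal_sqr. ring.
Qed.

Lemma parallelogram (H : HilbertSpace) (x y : H) :
  norm (plus x y) ^ 2 + norm (minus x y) ^ 2 = 2 * (norm x ^ 2 + norm y ^ 2).
Proof.
  replace (minus x y) with (plus x (scal (opp (one : C_Ring)) y))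
    by (unfold minus; f_equal; apply (scal_opp_one y)).
  rewrite !norm_sqr_inner, !inner_plus_l, !inner_plus_r, !inner_scal_l, !inner_scal_r.
  rewrite (inner_conj H x y).
  unfold Cconj, Cmult, Cplus, opp, one; simpl. ring.
Qed.

(** * Linear combinations of vectors *)

(** Reflection for vector identities: both sides are quoted over the list of their
    atoms, and it suffices to compare the complex coefficients of each atom. *)
Inductive vexp : Type :=
  | Vvar (i : nat)
  | Vzero
  | Vplus (e f : vexp)
  | Vopp (e : vexp)
  | Vscal (c : C) (e : vexp).

Fixpoint veval {H : HilbertSpace} (l : list H) (e : vexp) : H :=
  match e with
  | Vvar i => nth i l zero
  | Vzero => zero
  | Vplus e f => plus (veval l e) (veval l f)
  | Vopp e => opp (veval l e)
  | Vscal c e => scal c (veval l e)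
  end.

Fixpoint vcoef (e : vexp) (i : nat) : C :=
  match e with
  | Vvar j => if Nat.eqb i j then RtoC 1 else RtoC 0
  | Vzero => RtoC 0
  | Vplus e f => Cplus (vcoef e i) (vcoef f i)
  | Vopp e => Copp (vcoef e i)
  | Vscal c e => Cmult c (vcoef e i)
  end.

Fixpoint lincomb {H : HilbertSpace} (l : list H) (c : nat -> C) : H :=
  match l with
  | nil => zero
  | v :: l => plus (scal (c O) v) (lincomb l (fun i => c (S i)))
  end.

Lemma lincomb_ext (H : HilbertSpace) (l : list H) (c d : nat -> C) :
  (forall i, c i = d i) -> lincomb l c = lincomb l d.
Proof.
  revert c d; induction l as [|v l IH]; intros c d E; [reflexivity|].
  simpl. rewrite (E O). f_equal. apply IH. intros i; apply E.
Qed.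

Lemma lincomb_zero (H : HilbertSpace) (l : list H) :
  lincomb l (fun _ => RtoC 0) = zero.
Proof.
  induction l as [|v l IH]; [reflexivity|].
  simpl. rewrite IH, plus_zero_r. exact (scal_zero_l v).
Qed.

Lemma lincomb_plus (H : HilbertSpace) (l : list H) (c d : nat -> C) :
  lincomb l (fun i => Cplus (c i) (d i)) = plus (lincomb l c) (lincomb l d).
Proof.
  revert c d; induction l as [|v l IH]; intros c d.
  { symmetry; apply plus_zero_r. }
  simpl. rewrite (IH (fun i => c (S i)) (fun i => d (S i))).
  change (Cplus (c O) (d O)) with (plus (c O : C_Ring) (d O)).
  rewrite scal_distr_r, <- !plus_assoc. f_equal.
  rewrite !plus_assoc. f_equal. apply plus_comm.
Qed.

Lemma lincomb_scal (H : HilbertSpace) (l : list H) (a : C) (c : nat -> C) :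
  lincomb l (fun i => Cmult a (c i)) = scal a (lincomb l c).
Proof.
  revert c; induction l as [|v l IH]; intros c.
  { symmetry; exact (scal_zero_r (a : C_Ring)). }
  simpl. rewrite (IH (fun i => c (S i))).
  change (Cmult a (c O)) with (mult (a : C_Ring) (c O)).
  rewrite scal_distr_l, scal_assoc. reflexivity.
Qed.

Lemma veval_lincomb (H : HilbertSpace) (l : list H) (e : vexp) :
  veval l e = lincomb l (vcoef e).
Proof.
  induction e as [i| |e IHe f IHf|e IHe|c e IHe]; simpl.
  - revert i; induction l as [|v l IH]; intros i; simpl.
    { destruct i; reflexivity. }
    destruct i as [|i]; simpl.
    + rewrite lincomb_zero, plus_zero_r. symmetry; exact (scal_one v).
    + rewrite IH. rewrite <- (plus_zero_l (lincomb l _)) at 1. f_equal.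
      symmetry; exact (scal_zero_l v).
  - symmetry; apply lincomb_zero.
  - rewrite IHe, IHf. symmetry; exact (lincomb_plus H l (vcoef e) (vcoef f)).
  - rewrite IHe. transitivity (scal (opp (one : C_Ring)) (lincomb l (vcoef e)));
      [exact (eq_sym (scal_opp_one (lincomb l (vcoef e))))|].
    etransitivity; [symmetry; exact (lincomb_scal H l (opp (one : C_Ring)) (vcoef e))|].
    apply lincomb_ext; intros i. unfold opp, one; simpl. ring.
  - rewrite IHe. symmetry; apply lincomb_scal.
Qed.

Lemma veval_eq (H : HilbertSpace) (l : list H) (e f : vexp) :
  lincomb l (vcoef e) = lincomb l (vcoef f) -> veval l e = veval l f.
Proof. rewrite !veval_lincomb. intros E; exact E. Qed.

Lemma lincomb_cons_eq (H : HilbertSpace) (v : H) (l : list H) (c d : nat -> C) :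
  c O = d O -> lincomb l (fun i => c (S i)) = lincomb l (fun i => d (S i)) ->
  lincomb (v :: l) c = lincomb (v :: l) d.
Proof. intros E F; simpl; rewrite E, F; reflexivity. Qed.

Ltac vec_insert x l :=
  match l with
  | nil => constr:(x :: nil)
  | x :: _ => l
  | ?y :: ?t => let t' := vec_insert x t in constr:(y :: t')
  end.

Ltac vec_atoms e l :=
  match e with
  | @zero _ => l
  | plus ?a ?b => let l := vec_atoms a l in vec_atoms b l
  | minus ?a ?b => let l := vec_atoms a l in vec_atoms b l
  | opp ?a => vec_atoms a l
  | scal _ ?a => vec_atoms a l
  | _ => vec_insert e l
  end.

Ltac vec_index x l :=
  match l with
  | x :: _ => constr:(O)
  | _ :: ?t => let n := vec_index x t in constr:(Datatypes.S n)
  end.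

Ltac vec_quote e l :=
  match e with
  | @zero _ => constr:(Vzero)
  | plus ?a ?b => let a := vec_quote a l in let b := vec_quote b l in constr:(Vplus a b)
  | minus ?a ?b => let a := vec_quote a l in let b := vec_quote b l in
                   constr:(Vplus a (Vopp b))
  | opp ?a => let a := vec_quote a l in constr:(Vopp a)
  | scal ?c ?a => let a := vec_quote a l in constr:(Vscal c a)
  | _ => let i := vec_index e l in constr:(Vvar i)
  end.

(** Reduces an equality of vectors to one equality in the field of complex numbers
    per atom. *)
Ltac vec_coefs :=
  match goal with
  | |- ?a = ?b =>
    let H := match type of a with
             | context [hilbert_carrier ?H] => H
             end in
    let l := vec_atoms a (@nil H) in
    let l := vec_atoms b l in
    let e := vec_quote a l in
    let f := vec_quote b l in
    change (veval l e = veval l f); apply veval_eq;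
    repeat (apply lincomb_cons_eq; [cbn [vcoef Nat.eqb]|]); try reflexivity
  end.


(** * A discrete Plancherel inequality *)

(** Half-open ranges let a sum of length [m + n] split without boundary terms. *)
Fixpoint sum_below (f : nat -> R) (n : nat) : R :=
  match n with
  | O => 0
  | S n => sum_below f n + f n
  end.

Lemma sum_below_ext (f g : nat -> R) (n : nat) :
  (forall j, (j < n)%nat -> f j = g j) -> sum_below f n = sum_below g n.
Proof.
  induction n as [|n IH]; intros E; [reflexivity|].
  simpl. rewrite E by lia. rewrite IH; [reflexivity|]. intros j Hj; apply E; lia.
Qed.

Lemma sum_below_le (f g : nat -> R) (n : nat) :
  (forall j, (j < n)%nat -> f j <= g j) -> sum_below f n <= sum_below g n.
Proof.
  induction n as [|n IH]; intros E; [apply Rle_refl|].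
  simpl. apply Rplus_le_compat; [|apply E; lia]. apply IH. intros j Hj; apply E; lia.
Qed.

Lemma sum_below_plus (f g : nat -> R) (n : nat) :
  sum_below (fun j => f j + g j) n = sum_below f n + sum_below g n.
Proof. induction n as [|n IH]; simpl; [ring | rewrite IH; ring]. Qed.

Lemma sum_below_mult (c : R) (f : nat -> R) (n : nat) :
  sum_below (fun j => c * f j) n = c * sum_below f n.
Proof. induction n as [|n IH]; simpl; [ring | rewrite IH; ring]. Qed.

Lemma sum_below_const (c : R) (n : nat) : sum_below (fun _ => c) n = INR n * c.
Proof. induction n as [|n IH]; [simpl; ring | rewrite S_INR; simpl; rewrite IH; ring]. Qed.

Lemma sum_below_split (f : nat -> R) (m n : nat) :
  sum_below f (m + n) = sum_below f m + sum_below (fun j => f (m + j)%nat) n.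
Proof.
  induction n as [|n IH]; [rewrite Nat.add_0_r; simpl; ring|].
  rewrite Nat.add_succ_r. simpl. rewrite IH. ring.
Qed.

Definition cis (alpha : R) : C := (cos alpha, sin alpha).

Lemma Cmod_cis (alpha : R) : Cmod (cis alpha) = 1.
Proof.
  unfold Cmod, cis; simpl. rewrite !Rmult_1_r, Rplus_comm.
  change (sqrt (Rsqr (sin alpha) + Rsqr (cos alpha)) = 1).
  rewrite sin2_cos2. apply sqrt_1.
Qed.

Lemma cis_plus (alpha beta : R) : cis (alpha + beta) = Cmult (cis alpha) (cis beta).
Proof.
  unfold cis, Cmult; simpl. rewrite cos_plus, sin_plus. f_equal; ring.
Qed.

Lemma cis_0 : cis 0 = RtoC 1.
Proof. unfold cis. rewrite cos_0, sin_0. reflexivity. Qed.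

Lemma cis_PI : cis PI = Copp (RtoC 1).
Proof. unfold cis, Copp. rewrite cos_PI, sin_PI. simpl. f_equal; ring. Qed.

(** Unbounded operators are handled through their graphs. *)
Definition linear_graph {H : HilbertSpace} (G : H -> H -> Prop) : Prop :=
  (forall x y x' y', G x y -> G x' y' -> G (plus x x') (plus y y')) /\
  (forall c x y, G x y -> G (scal c x) (scal c y)).

(** The only trace of the resolvent bound kept below: it says that [z - A] is bounded
    below by [r], and it passes to damped semigroups and to smaller half-planes. *)
Definition coercive_on_half_plane {H : HilbertSpace} (G : H -> H -> Prop)
    (omega r : R) : Prop :=
  forall (z : C) (x y : H), omega <= Re z -> G x y ->
    r * norm x <= norm (minus (scal z x) y).

(** The residual of the implicit Euler scheme; implicit, so that the symbol of the
    difference quotient has nonnegative real part. *)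
Definition euler_defect {H : HilbertSpace} (h : R) (x y : nat -> H) (j : nat) : H :=
  minus (scal (RtoC (/ h)) (minus (x (S j)) (x j))) (y (S j)).

(** For one step, [x 1 = e^{i alpha} x 0] makes the defect equal to [z x - y] with
    [z = (1 - e^{-i alpha}) / h], and [Re z >= 0]. A sequence of length [2 N] and phase
    [alpha] splits into the two sequences [x_j +- e^{-i alpha/2} x_{N+j}] of length [N]
    with phases [alpha/2] and [alpha/2 + PI]; by the parallelogram law this splitting
    preserves, up to the factor 2, both sums of squares. Periodic sequences have phase
    [0], but halving produces other phases, so the induction runs over all of them. *)
Lemma quasi_periodic_euler_bound (H : HilbertSpace) (G : H -> H -> Prop) (r h : R) :
  0 <= r -> 0 < h -> linear_graph G -> coercive_on_half_plane G 0 r ->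
  forall (p : nat) (alpha : R) (x y : nat -> H),
  (forall j, G (x j) (y j)) ->
  x (2 ^ p)%nat = scal (cis alpha) (x O) ->
  r ^ 2 * sum_below (fun j => norm (x (S j)) ^ 2) (2 ^ p) <=
  sum_below (fun j => norm (euler_defect h x y j) ^ 2) (2 ^ p).
Proof.
  intros Hr Hh [Gplus Gscal] Hgap p.
  induction p as [|p IH]; intros alpha x y HG Hper.
  - simpl in Hper |- *. rewrite !Rplus_0_l.
    assert (E : euler_defect h x y 0 =
      minus (scal (Cmult (RtoC (/ h)) (Cminus (RtoC 1) (cis (- alpha)))) (x 1%nat)) (y 1%nat)).
    { unfold euler_defect.
      replace (x O) with (scal (cis (- alpha)) (x 1%nat)).
      - vec_coefs; ring.
      - rewrite Hper. rewrite scal_assoc. change mult with Cmult.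
        rewrite <- cis_plus, Rplus_opp_l, cis_0. exact (scal_one (x O)). }
    rewrite E.
    assert (Hz : 0 <= Re (Cmult (RtoC (/ h)) (Cminus (RtoC 1) (cis (- alpha))))).
    { unfold cis, Cminus, Cmult, RtoC, Re; simpl.
      pose proof (COS_bound (- alpha)). pose proof (Rinv_0_lt_compat h Hh).
      nra. }
    pose proof (Hgap _ _ _ Hz (HG 1%nat)) as Hg.
    pose proof (norm_ge_0 (x 1%nat)).
    assert (0 <= r * norm (x 1%nat)) by (apply Rmult_le_pos; assumption).
    match goal with |- _ <= ?n * (?n * 1) => set (n' := n) in * end.
    nra.
  - set (N := (2 ^ p)%nat) in *.
    assert (E2 : (2 ^ S p = N + N)%nat) by (unfold N; simpl; lia).
    rewrite E2 in Hper |- *.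
    (* [nu] is the inverse of a square root of the phase [e^{i alpha}]. *)
    set (nu := cis (- (alpha / 2))).
    assert (Emu : Cmult (cis (alpha / 2)) nu = RtoC 1).
    { unfold nu. rewrite <- cis_plus, Rplus_opp_r. apply cis_0. }
    assert (Enu : Cmult nu (cis alpha) = cis (alpha / 2)).
    { unfold nu. rewrite <- cis_plus. f_equal. field. }
    set (xp := fun j : nat => plus (x j) (scal nu (x (N + j)%nat)) : H).
    set (xm := fun j : nat => minus (x j) (scal nu (x (N + j)%nat)) : H).
    set (yp := fun j : nat => plus (y j) (scal nu (y (N + j)%nat)) : H).
    set (ym := fun j : nat => minus (y j) (scal nu (y (N + j)%nat)) : H).
    assert (Hxp : xp N = scal (cis (alpha / 2)) (xp O)).
    { unfold xp. rewrite Hper, Nat.add_0_r. vec_coefs.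
      - transitivity (Cmult (cis (alpha / 2)) nu); [rewrite Emu; ring | ring].
      - rewrite <- Enu; ring. }
    assert (Hxm : xm N = scal (cis (alpha / 2 + PI)) (xm O)).
    { unfold xm. rewrite Hper, Nat.add_0_r, cis_plus, cis_PI. vec_coefs.
      - transitivity (Cmult (cis (alpha / 2)) nu); [rewrite Emu; ring | ring].
      - rewrite <- Enu; ring. }
    assert (HGp : forall j, G (xp j) (yp j)).
    { intros j; apply Gplus; [|apply Gscal]; apply HG. }
    assert (HGm : forall j, G (xm j) (ym j)).
    { assert (Em : forall u v : H, minus u (scal nu v) = plus u (scal (Copp nu) v))
        by (intros u v; vec_coefs; ring).
      intros j. unfold xm, ym. rewrite !Em.
      apply Gplus; [|apply Gscal]; apply HG. }
    assert (Dp : forall j, euler_defect h xp yp j =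
        plus (euler_defect h x y j) (scal nu (euler_defect h x y (N + j)))).
    { intros j. unfold euler_defect, xp, yp. rewrite Nat.add_succ_r. vec_coefs; ring. }
    assert (Dm : forall j, euler_defect h xm ym j =
        minus (euler_defect h x y j) (scal nu (euler_defect h x y (N + j)))).
    { intros j. unfold euler_defect, xm, ym. rewrite Nat.add_succ_r. vec_coefs; ring. }
    assert (Par : forall u v : H,
      norm (plus u (scal nu v)) ^ 2 + norm (minus u (scal nu v)) ^ 2 =
      2 * norm u ^ 2 + 2 * norm v ^ 2).
    { intros u v. rewrite parallelogram, norm_scal_sqr. unfold nu. rewrite Cmod_cis. ring. }
    pose proof (IH _ xp yp HGp Hxp) as IHp.
    pose proof (IH _ xm ym HGm Hxm) as IHm.
    pose proof (Rplus_le_compat _ _ _ _ IHp IHm) as I.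
    rewrite <- Rmult_plus_distr_l, <- !sum_below_plus in I.
    rewrite (sum_below_ext
      (fun j => norm (euler_defect h xp yp j) ^ 2 + norm (euler_defect h xm ym j) ^ 2)
      (fun j => 2 * norm (euler_defect h x y j) ^ 2 +
                2 * norm (euler_defect h x y (N + j)) ^ 2)) in I
      by (intros j _; rewrite Dp, Dm; apply Par).
    rewrite (sum_below_ext
      (fun j => norm (xp (S j)) ^ 2 + norm (xm (S j)) ^ 2)
      (fun j => 2 * norm (x (S j)) ^ 2 + 2 * norm (x (S (N + j))) ^ 2)) in I
      by (intros j _; unfold xp, xm; rewrite Nat.add_succ_r; apply Par).
    rewrite !sum_below_plus, !sum_below_mult in I.
    rewrite !sum_below_split. lra.
Qed.

(** * Operator norms, generators and damping *)

Lemma linear_map_zero (H : HilbertSpace) (T : H -> H) : is_linear T -> T zero = zero.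
Proof. intros HT. exact (linear_zero T HT). Qed.

Lemma norm_zero_H (H : HilbertSpace) : norm (zero : H) = 0.
Proof. exact norm_zero. Qed.

(** Boundedness makes the supremum finite, so [real] in [op_norm] loses nothing. *)
Lemma op_norm_is_lub (H : HilbertSpace) (T : H -> H) :
  is_linear T ->
  is_lub (fun y : R => exists x : H, norm x <= 1 /\ y = norm (T x)) (op_norm T).
Proof.
  intros HT. destruct (linear_norm T HT) as [M [HM Hb]].
  unfold op_norm. set (E := fun y : R => exists x : H, norm x <= 1 /\ y = norm (T x)).
  destruct (Lub_Rbar_correct E) as [Hub Hleast].
  assert (H0 : E 0).
  { exists (zero : H). rewrite (linear_map_zero _ T HT), norm_zero_H. split; [lra | reflexivity]. }
  assert (HM' : Rbar_le (Lub_Rbar E) M).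
  { apply Hleast. intros y [x [Hx ->]]. simpl.
    apply Rle_trans with (1 := Hb x). pose proof (norm_ge_0 x). nra. }
  pose proof (Hub 0 H0) as H0'.
  destruct (Lub_Rbar E) as [l| |]; simpl in *; try tauto.
  split.
  - intros y Hy. exact (Hub y Hy).
  - intros b Hb'. exact (Hleast (Finite b) Hb').
Qed.

Lemma op_norm_ge_0 (H : HilbertSpace) (T : H -> H) : is_linear T -> 0 <= op_norm T.
Proof.
  intros HT. apply (proj1 (op_norm_is_lub H T HT)).
  exists (zero : H). rewrite (linear_map_zero _ T HT), norm_zero_H. split; [lra | reflexivity].
Qed.

Lemma norm_apply_le (H : HilbertSpace) (T : H -> H) (x : H) :
  is_linear T -> norm (T x) <= op_norm T * norm x.
Proof.
  intros HT. destruct (Req_dec (norm x) 0) as [E|E].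
  { assert (Ex : x = (zero : H)) by exact (norm_eq_zero x E).
    rewrite Ex, (linear_map_zero _ T HT), norm_zero_H. lra. }
  pose proof (norm_ge_0 x).
  set (c := RtoC (/ norm x)).
  assert (Hc : Cmod c = / norm x).
  { unfold c. rewrite Cmod_R. apply Rabs_right. left. apply Rinv_0_lt_compat. lra. }
  assert (I : norm (T (scal c x)) <= op_norm T).
  { apply (proj1 (op_norm_is_lub H T HT)). exists (scal c x). split; [|reflexivity].
    rewrite norm_scal_eq, Hc. right. field. exact E. }
  rewrite (linear_scal T HT), norm_scal_eq, Hc in I.
  apply Rmult_le_reg_l with (/ norm x); [apply Rinv_0_lt_compat; lra|].
  apply Rle_trans with (1 := I). right. field. exact E.
Qed.

Lemma op_norm_le (H : HilbertSpace) (T : H -> H) (K : R) :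
  is_linear T -> 0 <= K -> (forall x : H, norm (T x) <= K * norm x) -> op_norm T <= K.
Proof.
  intros HT HK Hb. apply (proj2 (op_norm_is_lub H T HT)).
  intros y [x [Hx ->]]. apply Rle_trans with (1 := Hb x). pose proof (norm_ge_0 x). nra.
Qed.

Lemma diff_quotient_lim_linear (H : HilbertSpace) (U : R -> H -> H) :
  is_C0_semigroup U -> linear_graph (diff_quotient_lim U).
Proof.
  intros HU. split.
  - intros x y x' y' Hx Hx'. unfold diff_quotient_lim in *.
    apply filterlim_ext_loc with
      (fun h => plus (scal (RtoC (/ h)) (minus (U h x) x))
                     (scal (RtoC (/ h)) (minus (U h x') x'))).
    + exists (mkposreal 1 Rlt_0_1). intros h _ Hh.
      rewrite (linear_plus _ (semigroup_bounded U HU h (Rlt_le _ _ Hh))).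
      vec_coefs; ring.
    + eapply filterlim_comp_2; [exact Hx | exact Hx' |]. exact (filterlim_plus y y').
  - intros c x y Hx. unfold diff_quotient_lim in *.
    apply filterlim_ext_loc with
      (fun h => scal c (scal (RtoC (/ h)) (minus (U h x) x))).
    + exists (mkposreal 1 Rlt_0_1). intros h _ Hh.
      rewrite (linear_scal _ (semigroup_bounded U HU h (Rlt_le _ _ Hh))).
      vec_coefs; ring.
    + eapply filterlim_comp; [exact Hx|]. exact (filterlim_scal_r (c : C_AbsRing) y).
Qed.

Lemma diff_quotient_lim_unique (H : HilbertSpace) (U : R -> H -> H) (x y y' : H) :
  diff_quotient_lim U x y -> diff_quotient_lim U x y' -> y = y'.
Proof. intros Hy Hy'. exact (filterlim_locally_unique _ _ _ Hy Hy'). Qed.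

(** Apply [|(z - A)^{-1} w| <= |w| / r] to [w = z x - A x]. *)
Lemma resolvent_coercive (H : HilbertSpace) (U : R -> H -> H) (A : operator H) (omega r : R) :
  is_generator U A -> resolvent_bounded_on_half_plane A omega -> 0 < r ->
  is_lub (resolvent_norms A omega) (1 / r) ->
  coercive_on_half_plane (diff_quotient_lim U) omega r.
Proof.
  intros [Hdom Happ] [M Hres] Hr [Hub _] z x y Hz Hxy.
  destruct (Hres z Hz) as [T [HT _]].
  assert (Hx : op_dom A x) by (apply Hdom; exists y; exact Hxy).
  pose proof (diff_quotient_lim_unique _ _ _ _ _ Hxy (Happ x Hx)) as Ey.
  assert (HTn : op_norm T <= 1 / r).
  { apply Hub. exists z, T. repeat split; try assumption; apply HT. }
  destruct HT as [HTl [_ HTinv]].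
  pose proof (norm_apply_le _ T (minus (scal z x) y) HTl) as I.
  rewrite Ey in I at 1. rewrite (HTinv x Hx) in I.
  pose proof (norm_ge_0 (minus (scal z x) y)).
  apply Rle_trans with (r * (1 / r * norm (minus (scal z x) y))).
  - apply Rmult_le_compat_l; [lra|]. nra.
  - right. field. lra.
Qed.

Lemma diff_quotient_lim_orbit (H : HilbertSpace) (U : R -> H -> H) (t : R) (x y : H) :
  is_C0_semigroup U -> 0 <= t ->
  diff_quotient_lim U x y -> diff_quotient_lim U (U t x) (U t y).
Proof.
  intros HU Ht Hxy. unfold diff_quotient_lim in *.
  pose proof (semigroup_bounded U HU t Ht) as Hlin.
  apply filterlim_ext_loc with (fun h => U t (scal (RtoC (/ h)) (minus (U h x) x))).
  - exists (mkposreal 1 Rlt_0_1). intros h _ Hh.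
    rewrite (linear_scal _ Hlin), (linear_minus _ _ _ Hlin).
    rewrite <- !(semigroup_plus U HU) by lra. rewrite Rplus_comm. reflexivity.
  - eapply filterlim_comp; [exact Hxy|]. exact (linear_cont (U t) y Hlin).
Qed.

(** Its generator is [A - omega], which moves the abscissa [omega] to [0]. *)
Definition damped {H : HilbertSpace} (omega : R) (U : R -> H -> H) (t : R) (x : H) : H :=
  scal (RtoC (exp (- omega * t))) (U t x).

Lemma norm_scal_exp (H : HilbertSpace) (s : R) (x : H) :
  norm (scal (RtoC (exp s)) x) = exp s * norm x.
Proof.
  rewrite norm_scal_eq, Cmod_R, Rabs_right; [reflexivity|]. left; apply exp_pos.
Qed.

Lemma orbit_at_right_0 (H : HilbertSpace) (U : R -> H -> H) (x : H) :
  is_C0_semigroup U -> filterlim (fun h => U h x) (at_right 0) (locally x).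
Proof.
  intros HU. pose proof (semigroup_cont U HU x 0 (Rle_refl 0)) as Hc. cbv beta in Hc.
  rewrite (semigroup_0 U HU) in Hc.
  intros P HP. destruct (Hc P HP) as [d Hd]. exists d. intros h Hh Hpos.
  apply Hd; [exact Hh | left; exact Hpos].
Qed.

Lemma RtoC_filterlim (F : (R -> Prop) -> Prop) (f : R -> R) (l : R) :
  Filter F -> filterlim f F (locally l) ->
  filterlim (fun t => RtoC (f t) : C_AbsRing) F (locally (RtoC l : C_AbsRing)).
Proof.
  intros HF Hf P [d Hd].
  pose proof (Hf (ball l d) (locally_ball l d)) as Hl. unfold filtermap in *.
  revert Hl. apply filter_imp. intros t Ht. apply Hd.
  change (Rabs (f t - l) < d) in Ht.
  change (Cmod (Cminus (RtoC (f t)) (RtoC l)) < d).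
  rewrite <- RtoC_minus, Cmod_R. exact Ht.
Qed.

Lemma damped_semigroup (H : HilbertSpace) (omega : R) (U : R -> H -> H) :
  is_C0_semigroup U -> is_C0_semigroup (damped omega U).
Proof.
  intros HU. split.
  - intros t Ht. apply (is_linear_comp (U t) (fun x : H => scal (RtoC (exp (- omega * t))) x)).
    + apply (semigroup_bounded U HU t Ht).
    + exact (@is_linear_scal_r C_AbsRing H (RtoC (exp (- omega * t))) Cmult_comm).
  - intros x. unfold damped. rewrite Rmult_0_r, exp_0, (semigroup_0 U HU).
    exact (scal_one x).
  - intros s t x Hs Ht. unfold damped.
    rewrite (linear_scal _ (semigroup_bounded U HU s Hs)), (semigroup_plus U HU) by assumption.
    rewrite Rmult_plus_distr_l, exp_plus, RtoC_mult. vec_coefs; ring.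
  - intros x t Ht. unfold damped.
    eapply (filterlim_comp_2 (fun t : R => RtoC (exp (- omega * t)) : C_AbsRing)
                            (fun t => U t x) (fun c y => scal c y)).
    + apply RtoC_filterlim; [apply within_filter, locally_filter|].
      intros P HP.
      assert (Hc : continuous (fun t => exp (- omega * t)) t).
      { apply continuous_comp; [|apply continuous_exp].
        apply (continuous_mult (fun _ => - omega) (fun t => t));
          [apply continuous_const | apply continuous_id]. }
      destruct (Hc P HP) as [d Hd]. exists d. intros s Hs _; exact (Hd s Hs).
    + exact (semigroup_cont U HU x t Ht).
    + apply (filterlim_scal (RtoC (exp (- omega * t)) : C_AbsRing) (U t x)).
Qed.

Lemma exp_quotient_at_right_0 (c : R) :
  filterlim (fun h => (exp (c * h) - 1) / h) (at_right 0) (locally c).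
Proof.
  assert (D : is_derive (fun h => exp (c * h)) 0 c).
  { auto_derive; [trivial|]. rewrite Rmult_0_r, exp_0. ring. }
  apply is_derive_Reals in D.
  intros P [d HP]. destruct (D d (cond_pos d)) as [e He].
  exists e. intros h Hh Hpos. apply HP.
  change (Rabs (h - 0) < e) in Hh. rewrite Rminus_0_r in Hh.
  specialize (He h (Rgt_not_eq _ _ Hpos) Hh).
  rewrite Rplus_0_l, Rmult_0_r, exp_0 in He. exact He.
Qed.

Lemma exp_at_right_0 (c : R) : filterlim (fun h => exp (c * h)) (at_right 0) (locally 1).
Proof.
  assert (Hc : continuous (fun t => exp (c * t)) 0).
  { apply continuous_comp; [|apply continuous_exp].
    apply (continuous_mult (fun _ => c) (fun t => t));
      [apply continuous_const | apply continuous_id]. }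
  unfold continuous in Hc. rewrite Rmult_0_r, exp_0 in Hc.
  intros P HP. destruct (Hc P HP) as [d Hd]. exists d. intros h Hh _. exact (Hd h Hh).
Qed.

Lemma diff_quotient_lim_damped (H : HilbertSpace) (omega : R) (U : R -> H -> H) (x y : H) :
  diff_quotient_lim U x y ->
  diff_quotient_lim (damped omega U) x (minus y (scal (RtoC omega) x)).
Proof.
  intros Hxy. unfold diff_quotient_lim in *.
  apply filterlim_ext_loc with
    (fun h => plus (scal (RtoC (exp (- omega * h))) (scal (RtoC (/ h)) (minus (U h x) x)))
                   (scal (RtoC ((exp (- omega * h) - 1) / h)) x)).
  { exists (mkposreal 1 Rlt_0_1). intros h _ Hh. unfold damped, Rdiv.
    rewrite RtoC_mult, RtoC_minus. vec_coefs; ring. }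
  replace (minus y (scal (RtoC omega) x))
    with (plus (scal (RtoC 1) y) (scal (RtoC (- omega)) x))
    by (rewrite RtoC_opp; vec_coefs; ring).
  eapply filterlim_comp_2;
    [| | exact (filterlim_plus (scal (RtoC 1) y) (scal (RtoC (- omega)) x))].
  - eapply (filterlim_comp_2 (fun h : R => RtoC (exp (- omega * h)) : C_AbsRing)
        (fun h => scal (RtoC (/ h)) (minus (U h x) x)) (fun c v => scal c v)).
    + apply RtoC_filterlim; [typeclasses eauto | apply exp_at_right_0].
    + exact Hxy.
    + apply (filterlim_scal (RtoC 1 : C_AbsRing) y).
  - apply (filterlim_comp _ _ _
      (fun h : R => RtoC ((exp (- omega * h) - 1) / h) : C_AbsRing) (fun c => scal c x)
      _ (locally (RtoC (- omega) : C_AbsRing))).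
    + apply RtoC_filterlim; [typeclasses eauto | apply exp_quotient_at_right_0].
    + apply (filterlim_scal_l (RtoC (- omega) : C_AbsRing) x).
Qed.

(** Damping by [- omega] undoes damping by [omega], so the graph of the damped
    generator is the graph of the original one shifted by [omega], and [z] becomes
    [z + omega]. *)
Lemma coercive_damped (H : HilbertSpace) (omega r : R) (U : R -> H -> H) :
  coercive_on_half_plane (diff_quotient_lim U) omega r ->
  coercive_on_half_plane (diff_quotient_lim (damped omega U)) 0 r.
Proof.
  intros Hc z x y Hz Hxy.
  assert (HU : diff_quotient_lim U x (plus y (scal (RtoC omega) x))).
  { pose proof (diff_quotient_lim_damped H (- omega) _ x y Hxy) as Hd.
    rewrite RtoC_opp in Hd.
    replace (minus y (scal (Copp (RtoC omega)) x)) with (plus y (scal (RtoC omega) x)) in Hd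
      by (vec_coefs; ring).
    revert Hd. apply filterlim_ext. intros h. unfold damped. f_equal. f_equal.
    transitivity (scal (Cmult (RtoC (exp (- - omega * h))) (RtoC (exp (- omega * h)))) (U h x)).
    { vec_coefs; ring. }
    rewrite <- RtoC_mult, <- exp_plus.
    replace (- - omega * h + - omega * h) with 0 by ring. rewrite exp_0. exact (scal_one _). }
  assert (Hz' : omega <= Re (Cplus z (RtoC omega))).
  { unfold Re in *; simpl. lra. }
  apply Rle_trans with (1 := Hc _ _ _ Hz' HU). right. f_equal. vec_coefs; ring.
Qed.

Lemma coercive_half_plane_le (H : HilbertSpace) (G : H -> H -> Prop) (omega omega' r : R) :
  omega <= omega' -> coercive_on_half_plane G omega r -> coercive_on_half_plane G omega' r.
Proof. intros Hle Hc z x y Hz. apply Hc. lra. Qed.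

(** * The energy inequality *)

(** Freezing a function at negative times gives one that is continuous on the whole
    line, which removes boundary conditions from all integrals below. *)
Lemma continuous_Rmax_0 (V : UniformSpace) (f : R -> V) :
  continuous_on (fun t => 0 <= t) f -> forall s, continuous (fun s => f (Rmax 0 s)) s.
Proof.
  intros Hf s P HP.
  destruct (Hf (Rmax 0 s) (Rmax_l 0 s) P HP) as [d Hd].
  exists d. intros s' Hs'. apply Hd; [|apply Rmax_l].
  change (Rabs (s' - s) < d) in Hs'.
  change (Rabs (Rmax 0 s' - Rmax 0 s) < d).
  apply Rle_lt_trans with (2 := Hs').
  unfold Rmax, Rabs.
  repeat (destruct Rle_dec || destruct Rcase_abs); lra.
Qed.

Lemma continuous_sqr (f : R -> R) (s : R) :
  continuous f s -> continuous (fun s => f s ^ 2) s.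
Proof.
  intros Hf. apply (continuous_ext (fun s => f s * f s)); [intros; simpl; ring|].
  exact (continuous_mult f f s Hf Hf).
Qed.

Definition orbit_sqr {H : HilbertSpace} (U : R -> H -> H) (u : H) (s : R) : R :=
  norm (U (Rmax 0 s) u) ^ 2.

Lemma orbit_sqr_continuous (H : HilbertSpace) (U : R -> H -> H) (u : H) :
  is_C0_semigroup U -> forall s, continuous (orbit_sqr U u) s.
Proof.
  intros HU s. apply continuous_sqr.
  apply (continuous_comp (fun s => U (Rmax 0 s) u) norm).
  - apply (continuous_Rmax_0 _ (fun t => U t u)), (semigroup_cont U HU).
  - exact (filterlim_norm _).
Qed.

Lemma orbit_sqr_ge_0 (H : HilbertSpace) (U : R -> H -> H) (u : H) (s : R) :
  0 <= orbit_sqr U u s.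
Proof. apply pow2_ge_0. Qed.

Lemma ex_RInt_cont (f : R -> R) (a b : R) : (forall s, continuous f s) -> ex_RInt f a b.
Proof. intros Hf. apply (ex_RInt_continuous (V := R_CompleteNormedModule)). intros; apply Hf. Qed.

Lemma RInt_correct_R (f : R -> R) (a b : R) :
  ex_RInt f a b -> is_RInt f a b (RInt f a b).
Proof. exact (RInt_correct (V := R_CompleteNormedModule) f a b). Qed.

Lemma ex_RInt_ext_R (f g : R -> R) (a b : R) :
  (forall s, f s = g s) -> ex_RInt f a b -> ex_RInt g a b.
Proof. intros E. apply ex_RInt_ext. intros s _. apply E. Qed.

Lemma RInt_ext_R (f g : R -> R) (a b : R) :
  a <= b -> (forall s, a < s < b -> f s = g s) -> RInt f a b = RInt g a b.
Proof.
  intros Hab E. apply (RInt_ext f g). rewrite Rmin_left, Rmax_right by exact Hab. exact E.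
Qed.

Lemma RInt_const_R (c a b : R) : RInt (fun _ => c) a b = (b - a) * c.
Proof. exact (RInt_const (V := R_CompleteNormedModule) a b c). Qed.

Lemma RInt_Chasles_R (f : R -> R) (a b c : R) :
  ex_RInt f a b -> ex_RInt f b c -> RInt f a c = RInt f a b + RInt f b c.
Proof. intros Hab Hbc. symmetry. exact (RInt_Chasles f a b c Hab Hbc). Qed.

Lemma RInt_scal_R (f : R -> R) (l a b : R) :
  ex_RInt f a b -> RInt (fun s => l * f s) a b = l * RInt f a b.
Proof. exact (RInt_scal (V := R_CompleteNormedModule) f a b l). Qed.

(** Cauchy-Schwarz against the constant 1: expand the integral of [(f - c)^2] for [c]
    the mean value of [f]. *)
Lemma RInt_sqr_le (f : R -> R) (a b : R) :
  a <= b -> ex_RInt f a b -> ex_RInt (fun s => f s ^ 2) a b ->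
  RInt f a b ^ 2 <= (b - a) * RInt (fun s => f s ^ 2) a b.
Proof.
  intros Hab Hf Hf2.
  destruct (Req_dec a b) as [E|E].
  { subst b. rewrite !RInt_point. unfold zero; simpl. lra. }
  set (c := RInt f a b / (b - a)).
  assert (I : is_RInt (fun s => (f s - c) ^ 2) a b
     (RInt (fun s => f s ^ 2) a b + ((- 2 * c) * RInt f a b + (b - a) * c ^ 2))).
  { apply (is_RInt_ext (fun s => plus (f s ^ 2) (plus (scal (- 2 * c) (f s)) (c ^ 2)))).
    { intros s _. unfold plus, scal; simpl. unfold mult; simpl. ring. }
    apply @is_RInt_plus; [apply RInt_correct_R, Hf2|].
    apply @is_RInt_plus; [apply @is_RInt_scal, RInt_correct_R; exact Hf|].
    exact (is_RInt_const a b (c ^ 2)). }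
  assert (P : 0 <= RInt (fun s => (f s - c) ^ 2) a b).
  { apply RInt_ge_0; [exact Hab | eexists; exact I | intros; apply pow2_ge_0]. }
  rewrite (is_RInt_unique _ _ _ _ I) in P.
  assert (Ec : c * (b - a) = RInt f a b) by (unfold c; field; lra).
  rewrite <- Ec in P |- *. nra.
Qed.

Lemma RInt_uniform_partition (k : R -> R) (h : R) (n : nat) :
  (forall a b, ex_RInt k a b) ->
  RInt k 0 (INR n * h) = sum_below (fun j => RInt k (INR j * h) (INR (S j) * h)) n.
Proof.
  intros Hk. induction n as [|n IH].
  - simpl. rewrite Rmult_0_l. exact (RInt_point 0 k).
  - change (RInt k 0 (INR (S n) * h) =
      sum_below (fun j => RInt k (INR j * h) (INR (S j) * h)) n
      + RInt k (INR n * h) (INR (S n) * h)).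
    rewrite <- IH. symmetry. exact (RInt_Chasles k _ _ _ (Hk _ _) (Hk _ _)).
Qed.

Lemma partition_point_bounds (h : R) (n j : nat) :
  0 < h -> (j < n)%nat ->
  0 <= INR j * h /\ INR (S j) * h = INR j * h + h /\ INR j * h + h <= INR n * h.
Proof.
  intros Hh Hj. pose proof (pos_INR j). pose proof (le_INR _ _ Hj) as I.
  rewrite S_INR in I |- *. repeat split; nra.
Qed.

Lemma RInt_le_right_sum (k : R -> R) (h eps : R) (n : nat) :
  0 < h -> (forall s, continuous k s) ->
  (forall s s', 0 <= s <= INR n * h -> 0 <= s' <= INR n * h -> Rabs (s - s') <= h ->
     Rabs (k s - k s') <= eps) ->
  RInt k 0 (INR n * h) <= h * sum_below (fun j => k (INR (S j) * h)) n + INR n * h * eps.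
Proof.
  intros Hh Hk Hu. rewrite RInt_uniform_partition by (intros; apply ex_RInt_cont, Hk).
  apply Rle_trans with (sum_below (fun j => h * k (INR (S j) * h) + h * eps) n).
  - apply sum_below_le. intros j Hj.
    destruct (partition_point_bounds h n j Hh Hj) as [B1 [B2 B3]].
    apply Rle_trans with (RInt (fun _ => k (INR (S j) * h) + eps) (INR j * h) (INR (S j) * h)).
    + apply RInt_le; [lra | apply ex_RInt_cont, Hk | apply @ex_RInt_const |].
      intros s Hs.
      assert (I : Rabs (k s - k (INR (S j) * h)) <= eps).
      { apply Hu; [lra | lra |]. rewrite Rabs_left1; lra. }
      apply Rabs_le_between in I. lra.
    + rewrite RInt_const.
      change ((INR (S j) * h - INR j * h) * (k (INR (S j) * h) + eps) <=
              h * k (INR (S j) * h) + h * eps).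
      right. replace (INR (S j) * h - INR j * h) with h by lra. ring.
  - rewrite sum_below_plus, sum_below_mult, sum_below_const. lra.
Qed.

(** Only [g] is sampled; [e] may jump, as the square of the derivative of a piecewise
    smooth cutoff does. *)
Lemma left_sum_le_RInt (e g : R -> R) (h eps : R) (n : nat) :
  0 < h -> (forall s, 0 <= e s) -> (forall a b, ex_RInt e a b) ->
  (forall a b, ex_RInt (fun s => e s * g s) a b) ->
  (forall s s', 0 <= s <= INR n * h -> 0 <= s' <= INR n * h -> Rabs (s - s') <= h ->
     Rabs (g s - g s') <= eps) ->
  sum_below (fun j => g (INR j * h) * RInt e (INR j * h) (INR (S j) * h)) n <=
  RInt (fun s => e s * g s) 0 (INR n * h) + eps * RInt e 0 (INR n * h).
Proof.
  intros Hh He0 He Heg Hu.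
  rewrite !RInt_uniform_partition by assumption.
  rewrite <- sum_below_mult, <- sum_below_plus.
  apply sum_below_le. intros j Hj.
  destruct (partition_point_bounds h n j Hh Hj) as [B1 [B2 B3]].
  set (a := INR j * h) in *. set (b := INR (S j) * h) in *.
  assert (I1 : is_RInt (fun s => scal (g a) (e s)) a b (scal (g a) (RInt e a b)))
    by (apply @is_RInt_scal, RInt_correct_R, He).
  assert (I2 : is_RInt (fun s => plus (e s * g s) (scal eps (e s))) a b
      (plus (RInt (fun s => e s * g s) a b) (scal eps (RInt e a b)))).
  { apply @is_RInt_plus; [apply RInt_correct_R, Heg | apply @is_RInt_scal, RInt_correct_R, He]. }
  refine (is_RInt_le _ _ _ _ _ _ _ I1 I2 _); [lra|].
  intros s Hs. unfold plus, scal; simpl; unfold mult; simpl.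
  assert (I : Rabs (g a - g s) <= eps).
  { apply Hu; [lra | lra |]. rewrite Rabs_left1; lra. }
  apply Rabs_le_between in I. specialize (He0 s). nra.
Qed.

Lemma uniform_continuity_segment (k : R -> R) (L eps : R) :
  (forall s, continuous k s) -> 0 < eps ->
  exists d, 0 < d /\ forall h, h < d ->
    forall s s', 0 <= s <= L -> 0 <= s' <= L -> Rabs (s - s') <= h -> Rabs (k s - k s') <= eps.
Proof.
  intros Hk He.
  destruct (@Heine_cor2 k 0 L (fun s _ => proj2 (continuity_pt_filterlim k s) (Hk s))
             (mkposreal eps He)) as [d Hd].
  exists d. split; [apply cond_pos|]. intros h Hh s s' Hs Hs' Hss.
  left. apply Hd; [assumption | assumption | lra].
Qed.

Lemma exists_dyadic_step (L d : R) : 0 < L -> 0 < d -> exists p : nat, L / 2 ^ p < d.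
Proof.
  intros HL Hd.
  destruct (pow_lt_1_zero (/ 2) ltac:(rewrite Rabs_right; lra) (d / L)
             ltac:(apply Rdiv_lt_0_compat; assumption)) as [p Hp].
  exists p. specialize (Hp p (Nat.le_refl p)).
  rewrite pow_inv, Rabs_right in Hp
    by (apply Rle_ge; left; apply Rinv_0_lt_compat, pow_lt; lra).
  apply Rmult_lt_reg_l with (/ L); [apply Rinv_0_lt_compat; exact HL|].
  apply Rle_lt_trans with (/ 2 ^ p); [|apply Rlt_le_trans with (1 := Hp)].
  - right; field. split; [apply pow_nonzero; lra | lra].
  - right; field. lra.
Qed.

Lemma sqr_plus_le_weighted (a b eps : R) :
  0 < eps -> (a + b) ^ 2 <= (1 + eps) * a ^ 2 + (1 + / eps) * b ^ 2.
Proof.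
  intros He.
  assert (E : (1 + eps) * a ^ 2 + (1 + / eps) * b ^ 2 - (a + b) ^ 2
              = / eps * (eps * a - b) ^ 2) by (field; lra).
  pose proof (Rmult_le_pos _ _ (Rlt_le _ _ (Rinv_0_lt_compat _ He)) (pow2_ge_0 (eps * a - b))).
  lra.
Qed.

Lemma norm_minus_le (H : HilbertSpace) (x y : H) : norm (minus x y) <= norm x + norm y.
Proof.
  apply Rle_trans with (norm x + norm (opp y)); [exact (norm_triangle x (opp y))|].
  right. f_equal. exact (norm_opp y).
Qed.

(** The consistency error of one implicit Euler step along an orbit: both terms tend
    to the generator applied to [u]. *)
Lemma generator_consistency (H : HilbertSpace) (U : R -> H -> H) (u y : H) (eps : R) :
  is_C0_semigroup U -> diff_quotient_lim U u y -> 0 < eps ->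
  exists d, 0 < d /\ forall h, 0 < h < d ->
    norm (minus (scal (RtoC (/ h)) (minus (U h u) u)) (U h y)) <= eps.
Proof.
  intros HU Huy He.
  assert (He2 : 0 < eps / 2) by lra.
  destruct (Huy _ (locally_ball_norm y (mkposreal _ He2))) as [d1 Hd1].
  destruct (orbit_at_right_0 _ U y HU _ (locally_ball_norm y (mkposreal _ He2))) as [d2 Hd2].
  exists (Rmin d1 d2). split; [apply Rmin_pos; apply cond_pos|].
  intros h [Hh0 Hh].
  assert (B1 : ball 0 d1 h).
  { change (Rabs (h - 0) < d1). rewrite Rminus_0_r, Rabs_right by lra.
    apply Rlt_le_trans with (1 := Hh), Rmin_l. }
  assert (B2 : ball 0 d2 h).
  { change (Rabs (h - 0) < d2). rewrite Rminus_0_r, Rabs_right by lra.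
    apply Rlt_le_trans with (1 := Hh), Rmin_r. }
  assert (I1 : norm (minus (scal (RtoC (/ h)) (minus (U h u) u)) y : H) < eps / 2)
    by exact (Hd1 h B1 Hh0).
  assert (I2 : norm (minus (U h y) y : H) < eps / 2) by exact (Hd2 h B2 Hh0).
  replace (minus (scal (RtoC (/ h)) (minus (U h u) u)) (U h y))
    with (minus (minus (scal (RtoC (/ h)) (minus (U h u) u)) y) (minus (U h y) y))
    by (vec_coefs; ring).
  eapply Rle_trans; [apply norm_minus_le|]. lra.
Qed.

Lemma continuous_primitive (f : R -> R) (s : R) :
  (forall a b, ex_RInt f a b) -> continuous (fun s => RInt f 0 s) s.
Proof.
  intros Hf. apply (continuous_RInt_1 f 0 s).
  apply filter_forall. intros z. apply RInt_correct_R, Hf.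
Qed.

(** The semigroup law reduces the consistency error at time [j h] to the one at time 0,
    transported by [U (j h)]. *)
Lemma norm_euler_defect_le (H : HilbertSpace) (U : R -> H -> H) (u y : H)
    (phi : nat -> R) (M h eps : R) (j : nat) :
  is_C0_semigroup U -> 0 < h -> 0 < eps -> 0 <= M ->
  (forall v, norm (U (INR j * h) v) <= M * norm v) ->
  norm (minus (scal (RtoC (/ h)) (minus (U h u) u)) (U h y)) <= eps ->
  norm (euler_defect h (fun j => scal (RtoC (phi j)) (U (INR j * h) u))
                       (fun j => scal (RtoC (phi j)) (U (INR j * h) y)) j) ^ 2 <=
  (1 + eps) * ((phi (S j) - phi j) / h) ^ 2 * norm (U (INR j * h) u) ^ 2
  + (1 + / eps) * (phi (S j) ^ 2 * (M * eps) ^ 2).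
Proof.
  intros HU Hh He HM0 HM Heta.
  set (t := INR j * h) in *.
  assert (Ht : 0 <= t) by (apply Rmult_le_pos; [apply pos_INR | lra]).
  assert (Et : INR (S j) * h = t + h) by (rewrite S_INR; unfold t; ring).
  pose proof (semigroup_bounded U HU t Ht) as Hlin.
  set (eta := minus (scal (RtoC (/ h)) (minus (U h u) u)) (U h y)) in *.
  assert (E : euler_defect h (fun j => scal (RtoC (phi j)) (U (INR j * h) u))
                       (fun j => scal (RtoC (phi j)) (U (INR j * h) y)) j =
    plus (scal (RtoC ((phi (S j) - phi j) / h)) (U t u)) (scal (RtoC (phi (S j))) (U t eta))).
  { unfold euler_defect, eta. fold t. rewrite Et.
    rewrite !(semigroup_plus U HU t h) by lra.
    rewrite (linear_minus _ _ _ Hlin), (linear_scal _ Hlin), (linear_minus _ _ _ Hlin).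
    unfold Rdiv. rewrite RtoC_mult, RtoC_minus. vec_coefs; ring. }
  rewrite E.
  assert (N1 : forall (c : R) (v : H), norm (scal (RtoC c) v) = Rabs c * norm v)
    by (intros c v; rewrite norm_scal_eq, Cmod_R; reflexivity).
  apply Rle_trans with
    ((Rabs ((phi (S j) - phi j) / h) * norm (U t u) + Rabs (phi (S j)) * norm (U t eta)) ^ 2).
  { apply pow_incr. split; [apply norm_ge_0|].
    rewrite <- !N1. exact (norm_triangle _ _). }
  eapply Rle_trans; [apply (sqr_plus_le_weighted _ _ eps He)|].
  rewrite !Rpow_mult_distr, !pow2_abs, <- Rmult_assoc.
  apply Rplus_le_compat_l. apply Rmult_le_compat_l.
  { pose proof (Rinv_0_lt_compat _ He). lra. }
  apply Rmult_le_compat_l; [apply pow2_ge_0|].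
  rewrite <- Rpow_mult_distr.
  apply pow_incr. split; [apply norm_ge_0|].
  apply Rle_trans with (1 := HM eta).
  apply Rmult_le_compat_l; assumption.
Qed.

(** Here [phi], the primitive of [f], vanishes at both ends of [0, L], so the sampled
    sequence [phi(j h) U(j h) u] is periodic. Its squared norms form a Riemann sum of
    the left-hand side; by Cauchy-Schwarz on each cell, the squares of the difference
    quotients of [phi] are dominated by integrals of [f^2], and the defects by the
    right-hand side. *)
Lemma energy_inequality (H : HilbertSpace) (U : R -> H -> H) (r M L : R) (f : R -> R) (u y : H) :
  is_C0_semigroup U -> 0 < r -> 0 < L -> 0 <= M ->
  coercive_on_half_plane (diff_quotient_lim U) 0 r ->
  (forall t v, 0 <= t <= L -> norm (U t v) <= M * norm v) ->
  diff_quotient_lim U u y ->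
  (forall a b, ex_RInt f a b) -> (forall a b, ex_RInt (fun s => f s ^ 2) a b) ->
  (forall a b, ex_RInt (fun s => f s ^ 2 * orbit_sqr U u s) a b) ->
  RInt f 0 L = 0 ->
  r ^ 2 * RInt (fun s => RInt f 0 s ^ 2 * orbit_sqr U u s) 0 L <=
  RInt (fun s => f s ^ 2 * orbit_sqr U u s) 0 L.
Proof.
  intros HU Hr HL HM Hco HUM Huy Hf Hf2 Hf2g HfL.
  set (g := orbit_sqr U u) in *.
  set (phi := fun s => RInt f 0 s).
  set (k := fun s => phi s ^ 2 * g s).
  set (E := RInt (fun s => f s ^ 2) 0 L).
  set (Y := RInt (fun s => f s ^ 2 * g s) 0 L).
  change (r ^ 2 * RInt k 0 L <= Y).
  assert (Hg : forall s, continuous g s) by (apply orbit_sqr_continuous, HU).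
  assert (Hk : forall s, continuous k s).
  { intros s. apply (continuous_mult (fun s => phi s ^ 2) g); [|apply Hg].
    apply continuous_sqr, continuous_primitive, Hf. }
  assert (HE : 0 <= E).
  { apply RInt_ge_0; [lra | apply Hf2 | intros; apply pow2_ge_0]. }
  assert (HY : 0 <= Y).
  { apply RInt_ge_0; [lra | apply Hf2g |].
    intros; apply Rmult_le_pos; [apply pow2_ge_0 | apply orbit_sqr_ge_0]. }
  assert (Hphi : forall s, 0 <= s <= L -> phi s ^ 2 <= L * E).
  { intros s Hs. eapply Rle_trans; [apply RInt_sqr_le; [lra | apply Hf | apply Hf2]|].
    assert (P : 0 <= RInt (fun s => f s ^ 2) s L).
    { apply RInt_ge_0; [lra | apply Hf2 | intros; apply pow2_ge_0]. }
    assert (P' : 0 <= RInt (fun s => f s ^ 2) 0 s).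
    { apply RInt_ge_0; [lra | apply Hf2 | intros; apply pow2_ge_0]. }
    assert (EC : RInt (fun s => f s ^ 2) 0 s + RInt (fun s => f s ^ 2) s L = E)
      by exact (RInt_Chasles _ _ _ _ (Hf2 _ _) (Hf2 _ _)).
    nra. }
  (* Collects the coefficients of [eps] in the estimate for [eps <= 1]. *)
  set (K := r ^ 2 * L + Y + 2 * E + 2 * L * (L * E * M ^ 2)).
  assert (HK : 0 <= K).
  { unfold K. pose proof (pow2_ge_0 r). pose proof (pow2_ge_0 M).
    assert (0 <= L * E) by (apply Rmult_le_pos; lra).
    assert (0 <= L * E * M ^ 2) by (apply Rmult_le_pos; lra).
    nra. }
  assert (Main : forall eps, 0 < eps -> eps <= 1 -> r ^ 2 * RInt k 0 L <= Y + eps * K).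
  { intros eps He He1.
    destruct (uniform_continuity_segment k L eps Hk He) as [d1 [Hd1 Huk]].
    destruct (uniform_continuity_segment g L eps Hg He) as [d2 [Hd2 Hug]].
    destruct (generator_consistency H U u y eps HU Huy He) as [d3 [Hd3 Heta]].
    destruct (exists_dyadic_step L (Rmin d1 (Rmin d2 d3)) HL
                ltac:(repeat apply Rmin_pos; assumption)) as [p Hp].
    (* A number of steps that is a power of 2, as the discrete inequality requires. *)
    set (h := L / 2 ^ p) in *.
    assert (Hh : 0 < h) by (apply Rdiv_lt_0_compat; [exact HL | apply pow_lt; lra]).
    assert (Hh1 : h < d1) by (apply Rlt_le_trans with (1 := Hp), Rmin_l).
    assert (Hh2 : h < d2).
    { apply Rlt_le_trans with (1 := Hp), Rle_trans with (1 := Rmin_r _ _), Rmin_l. }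
    assert (Hh3 : h < d3).
    { apply Rlt_le_trans with (1 := Hp), Rle_trans with (1 := Rmin_r _ _), Rmin_r. }
    assert (EL : INR (2 ^ p) * h = L).
    { rewrite pow_INR. replace (INR 2) with 2 by (simpl; ring).
      unfold h. field. apply pow_nonzero. lra. }
    set (N := (2 ^ p)%nat) in *.
    set (x := fun j : nat => scal (RtoC (phi (INR j * h))) (U (INR j * h) u) : H).
    set (z := fun j : nat => scal (RtoC (phi (INR j * h))) (U (INR j * h) y) : H).
    assert (Hgraph : forall j, diff_quotient_lim U (x j) (z j)).
    { intros j. apply (diff_quotient_lim_linear H U HU).
      apply diff_quotient_lim_orbit; [exact HU | | exact Huy].
      apply Rmult_le_pos; [apply pos_INR | lra]. }
    assert (phi0 : phi 0 = 0) by exact (RInt_point 0 f).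
    assert (Hper : x N = scal (cis 0) (x O)).
    { unfold x. rewrite EL. unfold phi at 1. rewrite HfL. simpl (INR 0).
      rewrite Rmult_0_l, phi0. vec_coefs; ring. }
    pose proof (quasi_periodic_euler_bound H _ r h (Rlt_le _ _ Hr) Hh
      (diff_quotient_lim_linear H U HU) Hco p 0 x z Hgraph Hper) as B.
    fold N in B.
    assert (Hgj : forall j, norm (U (INR j * h) u) ^ 2 = g (INR j * h)).
    { intros j. unfold g, orbit_sqr. rewrite Rmax_right; [reflexivity|].
      apply Rmult_le_pos; [apply pos_INR | lra]. }
    rewrite (sum_below_ext (fun j => norm (x (S j)) ^ 2) (fun j => k (INR (S j) * h))) in B.
    2: { intros j _. unfold x, k. rewrite norm_scal_sqr, Cmod_R, pow2_abs, Hgj. reflexivity. }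
    assert (Hdef : sum_below (fun j => norm (euler_defect h x z j) ^ 2) N <=
      sum_below (fun j => (1 + eps) / h *
         (g (INR j * h) * RInt (fun s => f s ^ 2) (INR j * h) (INR (S j) * h))
         + 2 * eps * (L * E * M ^ 2)) N).
    { apply sum_below_le. intros j Hj.
      destruct (partition_point_bounds h N j Hh Hj) as [B1 [B2 B3]].
      eapply Rle_trans.
      { apply (norm_euler_defect_le H U u y (fun j => phi (INR j * h)) M h eps j HU Hh He HM).
        - intros v. apply HUM. lra.
        - apply Heta. lra. }
      cbv beta. rewrite Hgj. apply Rplus_le_compat.
      - assert (D : phi (INR (S j) * h) - phi (INR j * h) = RInt f (INR j * h) (INR (S j) * h)).
        { assert (Ch : phi (INR j * h) + RInt f (INR j * h) (INR (S j) * h) =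
                       phi (INR (S j) * h))
            by exact (RInt_Chasles _ _ _ _ (Hf _ _) (Hf _ _)).
          lra. }
        pose proof (RInt_sqr_le f (INR j * h) (INR (S j) * h) ltac:(lra) (Hf _ _) (Hf2 _ _)) as I.
        rewrite <- D in I. replace (INR (S j) * h - INR j * h) with h in I by lra.
        set (q := phi (INR (S j) * h) - phi (INR j * h)) in *.
        set (e := RInt (fun s => f s ^ 2) (INR j * h) (INR (S j) * h)) in *.
        assert (I' : (q / h) ^ 2 <= e / h).
        { apply Rmult_le_reg_l with (h ^ 2); [apply pow_lt; exact Hh|].
          replace (h ^ 2 * (q / h) ^ 2) with (q ^ 2) by (field; lra).
          replace (h ^ 2 * (e / h)) with (h * e) by (field; lra). exact I. }
        replace ((1 + eps) / h * (g (INR j * h) * e))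
          with ((1 + eps) * (e / h) * g (INR j * h)) by (field; lra).
        apply Rmult_le_compat_r; [apply orbit_sqr_ge_0|].
        apply Rmult_le_compat_l; [lra | exact I'].
      - rewrite Rpow_mult_distr.
        assert (Hp2 : phi (INR (S j) * h) ^ 2 <= L * E) by (apply Hphi; lra).
        replace ((1 + / eps) * (phi (INR (S j) * h) ^ 2 * (M ^ 2 * eps ^ 2)))
          with ((eps ^ 2 + eps) * (phi (INR (S j) * h) ^ 2 * M ^ 2)) by (field; lra).
        pose proof (pow2_ge_0 M). pose proof (pow2_ge_0 (phi (INR (S j) * h))).
        apply Rmult_le_compat; [nra | apply Rmult_le_pos; lra | nra |].
        apply Rmult_le_compat_r; assumption. }
    rewrite sum_below_plus, sum_below_mult, sum_below_const in Hdef.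
    pose proof (left_sum_le_RInt (fun s => f s ^ 2) g h eps N Hh
      (fun s => pow2_ge_0 (f s)) Hf2 Hf2g) as I1.
    pose proof (RInt_le_right_sum k h eps N Hh Hk) as I2.
    rewrite EL in I1, I2.
    specialize (I1 (Hug h Hh2)). specialize (I2 (Huk h Hh1)).
    fold E Y in I1.
    set (Sg := sum_below (fun j => g (INR j * h) * _) N) in *.
    set (Sk := sum_below (fun j => k (INR (S j) * h)) N) in *.
    assert (J : r ^ 2 * (h * Sk) <= (1 + eps) * Sg + L * (2 * eps * (L * E * M ^ 2))).
    { rewrite <- EL at 1.
      replace ((1 + eps) * Sg + INR N * h * (2 * eps * (L * E * M ^ 2)))
        with (h * ((1 + eps) / h * Sg + INR N * (2 * eps * (L * E * M ^ 2)))) by (field; lra).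
      replace (r ^ 2 * (h * Sk)) with (h * (r ^ 2 * Sk)) by ring.
      apply Rmult_le_compat_l; lra. }
    pose proof (pow2_ge_0 r).
    unfold K. set (W := L * E * M ^ 2) in *.
    assert (eps * eps * E <= eps * E).
    { apply Rmult_le_compat_r; [exact HE | nra]. }
    assert ((1 + eps) * Sg <= (1 + eps) * (Y + eps * E)) by (apply Rmult_le_compat_l; lra).
    assert (r ^ 2 * RInt k 0 L <= r ^ 2 * (h * Sk + L * eps))
      by (apply Rmult_le_compat_l; lra).
    nra. }
  apply Rle_plus_epsilon. intros eps He.
  set (d := Rmin 1 (eps / (K + 1))).
  assert (Hd : 0 < d) by (apply Rmin_pos; [lra | apply Rdiv_lt_0_compat; lra]).
  apply Rle_trans with (1 := Main d Hd (Rmin_l _ _)).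
  assert (d * (K + 1) <= eps).
  { apply Rle_trans with (eps / (K + 1) * (K + 1)).
    - apply Rmult_le_compat_r; [lra | apply Rmin_r].
    - right; field; lra. }
  nra.
Qed.

(** * The tail estimate *)

Lemma exp_monotone (a b : R) : a <= b -> exp a <= exp b.
Proof. intros [I| ->]; [left; apply exp_increasing; exact I | apply Rle_refl]. Qed.

Lemma ex_RInt_glue (k1 k2 : R -> R) (c : R) :
  (forall a b, ex_RInt k1 a b) -> (forall a b, ex_RInt k2 a b) ->
  forall a b, ex_RInt (fun s => if Rlt_dec s c then k1 s else k2 s) a b.
Proof.
  intros H1 H2.
  set (k := fun s => if Rlt_dec s c then k1 s else k2 s).
  assert (Hc : forall x, ex_RInt k x c).
  { intros x. destruct (Rle_dec x c) as [Hx|Hx].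
    - apply (ex_RInt_ext k1); [|apply H1]. intros s. rewrite Rmin_left, Rmax_right by lra.
      intros Hs. unfold k. destruct (Rlt_dec s c); [reflexivity | lra].
    - apply (ex_RInt_ext k2); [|apply H2]. intros s. rewrite Rmin_right, Rmax_left by lra.
      intros Hs. unfold k. destruct (Rlt_dec s c); [lra | reflexivity]. }
  intros a b. apply (ex_RInt_Chasles k a c b); [apply Hc | apply ex_RInt_swap, Hc].
Qed.

Definition exp_bounded {H : HilbertSpace} (M kappa : R) (U : R -> H -> H) : Prop :=
  forall t v, 0 <= t -> norm (U t v) <= M * exp (kappa * t) * norm v.

(** The derivative of a function that follows the primitive of [f0] on [0, a], stays
    constant up to [T], and falls linearly on [T, T + D]. *)
Definition cutoff (f0 : R -> R) (a T D s : R) : R :=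
  if Rlt_dec s a then f0 s else if Rlt_dec s T then 0 else - / D.

Lemma window_estimate (H : HilbertSpace) (U : R -> H -> H) (r M kappa a T D : R)
    (f0 : R -> R) (u y : H) :
  is_C0_semigroup U -> 0 < r -> 0 <= M -> exp_bounded M kappa U ->
  coercive_on_half_plane (diff_quotient_lim U) 0 r ->
  diff_quotient_lim U u y ->
  0 < a -> a <= T -> 0 < D ->
  (forall s, continuous f0 s) -> RInt f0 0 a = 1 ->
  r ^ 2 * RInt (orbit_sqr U u) a T <=
  RInt (fun s => f0 s ^ 2 * orbit_sqr U u s) 0 a + (/ D) ^ 2 * RInt (orbit_sqr U u) T (T + D).
Proof.
  intros HU Hr HM HUM Hco Huy Ha HaT HD Hf0 Hf0a.
  set (g := orbit_sqr U u).
  assert (Hg : forall s, continuous g s) by (apply orbit_sqr_continuous, HU).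
  assert (Hg0 : forall s, 0 <= g s) by (apply orbit_sqr_ge_0).
  set (f := cutoff f0 a T D).
  assert (Hf : forall b c, ex_RInt f b c).
  { apply ex_RInt_glue; [intros; apply ex_RInt_cont, Hf0|].
    apply ex_RInt_glue; intros; apply @ex_RInt_const. }
  assert (Hf2 : forall b c, ex_RInt (fun s => f s ^ 2) b c).
  { intros b c.
    apply (ex_RInt_ext_R (fun s => if Rlt_dec s a then f0 s ^ 2 else
                                 if Rlt_dec s T then 0 else (- / D) ^ 2)).
    { intros s. unfold f, cutoff. destruct (Rlt_dec s a); [reflexivity|].
      destruct (Rlt_dec s T); [ring | reflexivity]. }
    revert b c. apply ex_RInt_glue; [intros; apply ex_RInt_cont; intros; apply continuous_sqr, Hf0|].
    apply ex_RInt_glue; intros; apply @ex_RInt_const. }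
  assert (Cf0g : forall s, continuous (fun s => f0 s ^ 2 * g s) s).
  { intros s. apply (continuous_mult (fun s => f0 s ^ 2) g); [apply continuous_sqr, Hf0 | apply Hg]. }
  assert (CDg : forall s, continuous (fun s => (/ D) ^ 2 * g s) s).
  { intros s. apply (continuous_mult (fun _ => (/ D) ^ 2) g); [apply continuous_const | apply Hg]. }
  assert (Hf2g : forall b c, ex_RInt (fun s => f s ^ 2 * g s) b c).
  { intros b c.
    apply (ex_RInt_ext_R (fun s => if Rlt_dec s a then f0 s ^ 2 * g s else
                                 if Rlt_dec s T then 0 else (/ D) ^ 2 * g s)).
    { intros s. unfold f, cutoff. destruct (Rlt_dec s a); [reflexivity|].
      destruct (Rlt_dec s T); ring. }
    revert b c. apply ex_RInt_glue; [intros; apply ex_RInt_cont, Cf0g|].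
    apply ex_RInt_glue; [intros; apply @ex_RInt_const | intros; apply ex_RInt_cont, CDg]. }
  assert (E1 : forall s, a <= s <= T -> (RInt f 0 s : R) = 1).
  { intros s Hs. rewrite (RInt_Chasles_R f 0 a s) by apply Hf.
    rewrite (RInt_ext_R f f0 0 a).
    2: lra.
    2: { intros x Hx. unfold f, cutoff.
         destruct (Rlt_dec x a); [reflexivity | lra]. }
    rewrite (RInt_ext_R f (fun _ => 0) a s).
    2: lra.
    2: { intros x Hx. unfold f, cutoff.
         destruct (Rlt_dec x a); [lra|]. destruct (Rlt_dec x T); [reflexivity | lra]. }
    rewrite Hf0a, RInt_const_R. ring. }
  assert (E0 : (RInt f 0 (T + D) : R) = 0).
  { rewrite (RInt_Chasles_R f 0 T (T + D)) by apply Hf. rewrite E1 by lra.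
    rewrite (RInt_ext_R f (fun _ => - / D) T (T + D)).
    2: lra.
    2: { intros x Hx. unfold f, cutoff.
         destruct (Rlt_dec x a); [lra|]. destruct (Rlt_dec x T); [lra | reflexivity]. }
    rewrite RInt_const_R. field. lra. }
  (* [Rabs kappa] because [kappa] may be negative. *)
  assert (HMb : forall t v, 0 <= t <= T + D -> norm (U t v) <=
                 M * exp (Rabs kappa * (T + D)) * norm v).
  { intros t v Ht. apply Rle_trans with (1 := HUM t v (proj1 Ht)).
    apply Rmult_le_compat_r; [apply norm_ge_0|]. apply Rmult_le_compat_l; [exact HM|].
    apply exp_monotone. pose proof (Rle_abs kappa). pose proof (Rabs_pos kappa). nra. }
  assert (HM' : 0 <= M * exp (Rabs kappa * (T + D))).
  { apply Rmult_le_pos; [exact HM | left; apply exp_pos]. }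
  pose proof (energy_inequality H U r _ (T + D) f u y HU Hr ltac:(lra) HM' Hco HMb Huy
    Hf Hf2 Hf2g E0) as I.
  fold g in I.
  set (k := fun s => RInt f 0 s ^ 2 * g s) in *.
  assert (Hk : forall b c, ex_RInt k b c).
  { intros b c. apply ex_RInt_cont. intros s.
    apply (continuous_mult (fun s => RInt f 0 s ^ 2) g); [|apply Hg].
    apply continuous_sqr, continuous_primitive, Hf. }
  assert (Hk0 : forall s, 0 <= k s) by (intros; apply Rmult_le_pos; [apply pow2_ge_0 | apply Hg0]).
  assert (L1 : RInt g a T <= RInt k 0 (T + D)).
  { assert (C1 : RInt k 0 a + RInt k a (T + D) = RInt k 0 (T + D))
      by exact (RInt_Chasles k _ _ _ (Hk _ _) (Hk _ _)).
    assert (C2 : RInt k a T + RInt k T (T + D) = RInt k a (T + D))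
      by exact (RInt_Chasles k _ _ _ (Hk _ _) (Hk _ _)).
    assert (P1 : 0 <= RInt k 0 a) by (apply RInt_ge_0; [lra | apply Hk | intros; apply Hk0]).
    assert (P2 : 0 <= RInt k T (T + D)) by (apply RInt_ge_0; [lra | apply Hk | intros; apply Hk0]).
    assert (P3 : RInt g a T = RInt k a T).
    { apply RInt_ext_R; [lra|]. intros s Hs.
      unfold k. rewrite E1 by lra. ring. }
    lra. }
  assert (L2 : (RInt (fun s => f s ^ 2 * g s) 0 (T + D) : R) =
     RInt (fun s => f0 s ^ 2 * g s) 0 a + (/ D) ^ 2 * RInt g T (T + D)).
  { rewrite (RInt_Chasles_R _ 0 T (T + D)) by apply Hf2g.
    rewrite (RInt_Chasles_R _ 0 a T) by apply Hf2g.
    rewrite (RInt_ext_R (fun s => f s ^ 2 * g s) (fun s => f0 s ^ 2 * g s) 0 a).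
    2: lra.
    2: { intros x Hx. unfold f, cutoff.
         destruct (Rlt_dec x a); [reflexivity | lra]. }
    rewrite (RInt_ext_R (fun s => f s ^ 2 * g s) (fun _ => 0) a T).
    2: lra.
    2: { intros x Hx. unfold f, cutoff.
         destruct (Rlt_dec x a); [lra|]. destruct (Rlt_dec x T); [ring | lra]. }
    rewrite (RInt_ext_R (fun s => f s ^ 2 * g s) (fun s => (/ D) ^ 2 * g s) T (T + D)).
    2: lra.
    2: { intros x Hx. unfold f, cutoff.
         destruct (Rlt_dec x a); [lra|]. destruct (Rlt_dec x T); [lra|]. ring. }
    rewrite RInt_scal_R by (apply ex_RInt_cont, Hg).
    rewrite RInt_const_R. ring. }
  rewrite L2 in I. apply Rle_trans with (2 := I).
  apply Rmult_le_compat_l; [apply pow2_ge_0 | exact L1].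
Qed.

Lemma exp_half_lt_2 : exp (/ 2) < 2.
Proof.
  pose proof exp_le_3. pose proof (exp_pos (/ 2)).
  assert (E : exp (/ 2) * exp (/ 2) = exp 1) by (rewrite <- exp_plus; f_equal; field).
  nra.
Qed.

(** A positive value of [w] would be multiplied by [2^n] at time [T + n / r], whereas
    the upper bound there grows only like [e^{n/2}], and [e^{1/2} < 2]. *)
Lemma doubling_dichotomy (w : R -> R) (r a C : R) :
  0 < r ->
  (forall T, a <= T -> 2 * w T <= w (T + / r)) ->
  (forall T, a <= T -> w T <= C * exp (r * T / 2)) ->
  forall T, a <= T -> w T <= 0.
Proof.
  intros Hr Hdbl Hub T HT.
  destruct (Rle_dec (w T) 0) as [Hw|Hw]; [exact Hw|]. exfalso.
  apply Rnot_le_lt in Hw.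
  assert (Hri : 0 < / r) by (apply Rinv_0_lt_compat; exact Hr).
  assert (Hn : forall n, 2 ^ n * w T <= w (T + INR n * / r)).
  { induction n as [|n IH].
    - simpl. rewrite Rmult_0_l, Rplus_0_r. lra.
    - pose proof (pos_INR n).
      assert (I := Hdbl (T + INR n * / r) ltac:(nra)).
      rewrite S_INR. replace (T + (INR n + 1) * / r) with (T + INR n * / r + / r) by ring.
      simpl. lra. }
  assert (Hq : forall n, w T <= C * exp (r * T / 2) * (exp (/ 2) / 2) ^ n).
  { intros n. apply Rmult_le_reg_l with (2 ^ n); [apply pow_lt; lra|].
    apply Rle_trans with (1 := Hn n).
    pose proof (pos_INR n).
    apply Rle_trans with (1 := Hub (T + INR n * / r) ltac:(nra)). right.
    replace (r * (T + INR n * / r) / 2) with (r * T / 2 + INR n * / 2) by (field; lra).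
    rewrite exp_plus.
    assert (En : exp (INR n * / 2) = exp (/ 2) ^ n).
    { clear. induction n as [|n IH]; [simpl; rewrite Rmult_0_l; apply exp_0|].
      rewrite S_INR, Rmult_plus_distr_r, exp_plus, IH, Rmult_1_l. simpl. ring. }
    rewrite En. unfold Rdiv. rewrite Rpow_mult_distr, pow_inv. field.
    apply pow_nonzero. lra. }
  set (B := C * exp (r * T / 2)) in *.
  pose proof (exp_pos (/ 2)). pose proof exp_half_lt_2.
  assert (HB : 0 < Rabs B + 1) by (pose proof (Rabs_pos B); lra).
  destruct (pow_lt_1_zero (exp (/ 2) / 2) ltac:(rewrite Rabs_right; lra)
      (w T / (Rabs B + 1)) ltac:(apply Rdiv_lt_0_compat; assumption)) as [n Hsmall].
  specialize (Hsmall n (Nat.le_refl n)). specialize (Hq n).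
  rewrite Rabs_right in Hsmall by (apply Rle_ge, pow_le; lra).
  set (q := (exp (/ 2) / 2) ^ n) in *.
  assert (Hq0 : 0 <= q) by (apply pow_le; lra).
  assert (I : q * (Rabs B + 1) < w T).
  { apply Rlt_le_trans with (w T / (Rabs B + 1) * (Rabs B + 1)).
    - apply Rmult_lt_compat_r; assumption.
    - right; field; lra. }
  pose proof (Rle_abs B). nra.
Qed.

(** With a window of length [1 / r], [window_estimate] says that the excess
    [r^2 int_a^T g - int_0^a f0^2 g] at time [T + 1 / r] is at least twice the excess
    at time [T]. *)
Lemma tail_energy_bound (H : HilbertSpace) (U : R -> H -> H) (r M kappa a C : R)
    (f0 : R -> R) (u y : H) :
  is_C0_semigroup U -> 0 < r -> 0 <= M -> exp_bounded M kappa U ->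
  coercive_on_half_plane (diff_quotient_lim U) 0 r ->
  diff_quotient_lim U u y -> 0 < a ->
  (forall s, continuous f0 s) -> RInt f0 0 a = 1 ->
  (forall T, a <= T -> RInt (orbit_sqr U u) a T <= C * exp (r * T / 2)) ->
  forall T, a <= T ->
  r ^ 2 * RInt (orbit_sqr U u) a T <= RInt (fun s => f0 s ^ 2 * orbit_sqr U u s) 0 a.
Proof.
  intros HU Hr HM HUM Hco Huy Ha Hf0 Hf0a HC T HT.
  assert (Hg : forall s, continuous (orbit_sqr U u) s) by (apply orbit_sqr_continuous, HU).
  set (g := orbit_sqr U u) in *.
  set (K := RInt (fun s => f0 s ^ 2 * g s) 0 a).
  assert (HK : 0 <= K).
  { apply RInt_ge_0; [lra | |].
    - apply ex_RInt_cont. intros s.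
      apply (continuous_mult (fun s => f0 s ^ 2) g); [apply continuous_sqr, Hf0 | apply Hg].
    - intros; apply Rmult_le_pos; [apply pow2_ge_0 | apply orbit_sqr_ge_0]. }
  assert (Hri : 0 < / r) by (apply Rinv_0_lt_compat; exact Hr).
  cut (r ^ 2 * RInt g a T - K <= 0); [lra|].
  apply (doubling_dichotomy (fun T => r ^ 2 * RInt g a T - K) r a (r ^ 2 * C) Hr); [| |exact HT].
  - intros S HS.
    pose proof (window_estimate H U r M kappa a S (/ r) f0 u y HU Hr HM HUM Hco Huy Ha HS Hri
      Hf0 Hf0a) as I.
    fold g in I. fold K in I. rewrite Rinv_inv in I.
    assert (Ch : RInt g a S + RInt g S (S + / r) = RInt g a (S + / r))
      by exact (RInt_Chasles g _ _ _ (ex_RInt_cont g _ _ Hg) (ex_RInt_cont g _ _ Hg)).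
    rewrite <- Ch. lra.
  - intros S HS. pose proof (HC S HS). pose proof (pow2_ge_0 r).
    assert (r ^ 2 * RInt g a S <= r ^ 2 * (C * exp (r * S / 2)))
      by (apply Rmult_le_compat_l; assumption).
    lra.
Qed.

(** * Descent to the abscissa of the half-plane *)

Lemma orbit_sqr_damped (H : HilbertSpace) (omega : R) (U : R -> H -> H) (u : H) (s : R) :
  0 <= s -> orbit_sqr (damped omega U) u s = exp (- 2 * omega * s) * orbit_sqr U u s.
Proof.
  intros Hs. unfold orbit_sqr, damped. rewrite Rmax_right by exact Hs.
  rewrite norm_scal_exp, Rpow_mult_distr. f_equal.
  simpl. rewrite Rmult_1_r, <- exp_plus. f_equal. ring.
Qed.

Lemma exp_bounded_damped (H : HilbertSpace) (omega M kappa : R) (U : R -> H -> H) :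
  exp_bounded M kappa U -> exp_bounded M (kappa - omega) (damped omega U).
Proof.
  intros HU t v Ht. unfold damped. rewrite norm_scal_exp.
  apply Rle_trans with (exp (- omega * t) * (M * exp (kappa * t) * norm v)).
  - apply Rmult_le_compat_l; [left; apply exp_pos | apply HU, Ht].
  - right. replace ((kappa - omega) * t) with (- omega * t + kappa * t) by ring.
    rewrite exp_plus. ring.
Qed.

(** The rate [r / 2] is what [doubling_dichotomy] can rule out at the scale [1 / r]. *)
Definition slow_energy_growth {H : HilbertSpace} (U : R -> H -> H) (r a : R) (u : H)
    (omega : R) : Prop :=
  exists C, forall T, a <= T -> RInt (orbit_sqr (damped omega U) u) a T <= C * exp (r * T / 2).

Lemma damped_tail_energy_bound (H : HilbertSpace) (U : R -> H -> H) (omega r M kappa a : R)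
    (f0 : R -> R) (u y : H) :
  is_C0_semigroup U -> 0 < r -> 0 <= M -> exp_bounded M kappa U ->
  coercive_on_half_plane (diff_quotient_lim U) omega r ->
  diff_quotient_lim U u y -> 0 < a ->
  (forall s, continuous f0 s) -> RInt f0 0 a = 1 ->
  slow_energy_growth U r a u omega ->
  forall T, a <= T ->
  r ^ 2 * RInt (orbit_sqr (damped omega U) u) a T <=
  RInt (fun s => f0 s ^ 2 * orbit_sqr (damped omega U) u s) 0 a.
Proof.
  intros HU Hr HM HUM Hco Huy Ha Hf0 Hf0a [C HC].
  exact (tail_energy_bound H (damped omega U) r M (kappa - omega) a C f0 u _
    (damped_semigroup H omega U HU) Hr HM (exp_bounded_damped H omega M kappa U HUM)
    (coercive_damped H omega r U Hco) (diff_quotient_lim_damped H omega U u y Huy)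
    Ha Hf0 Hf0a HC).
Qed.

Lemma slow_energy_growth_init (H : HilbertSpace) (U : R -> H -> H) (omega r M kappa a : R) (u : H) :
  is_C0_semigroup U -> 0 < r -> 0 <= M -> exp_bounded M kappa U -> 0 < a -> kappa <= omega ->
  slow_energy_growth U r a u omega.
Proof.
  intros HU Hr HM HUM Ha Hk.
  set (B := (M * norm u) ^ 2).
  assert (HB : 0 <= B) by apply pow2_ge_0.
  exists (B * (2 / r)). intros T HT.
  assert (Hg : forall s, continuous (orbit_sqr (damped omega U) u) s)
    by apply orbit_sqr_continuous, damped_semigroup, HU.
  apply Rle_trans with (RInt (fun _ => B) a T).
  - apply RInt_le; [exact HT | apply ex_RInt_cont, Hg | apply @ex_RInt_const |].
    intros s Hs. unfold orbit_sqr. rewrite Rmax_right by lra.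
    apply pow_incr. split; [apply norm_ge_0|].
    apply Rle_trans with (1 := exp_bounded_damped H omega M kappa U HUM s u ltac:(lra)).
    apply Rmult_le_compat_r; [apply norm_ge_0|].
    rewrite <- (Rmult_1_r M) at 2. apply Rmult_le_compat_l; [exact HM|].
    rewrite <- exp_0. apply exp_monotone. nra.
  - rewrite RInt_const_R, Rmult_comm, Rmult_assoc. apply Rmult_le_compat_l; [exact HB|].
    pose proof (exp_ineq1_le (r * T / 2)) as I.
    apply Rle_trans with (2 / r * (r * T / 2)).
    + replace (2 / r * (r * T / 2)) with T by (field; lra). lra.
    + apply Rmult_le_compat_l; [left; apply Rdiv_lt_0_compat; lra | lra].
Qed.

(** The tail estimate makes the energy at exponent [omega + r / 4] bounded, and lowering
    the exponent by [r / 4] costs a factor [e^{rT/2}] on [a, T]. *)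
Lemma slow_energy_growth_step (H : HilbertSpace) (U : R -> H -> H) (omega r M kappa a : R)
    (f0 : R -> R) (u y : H) :
  is_C0_semigroup U -> 0 < r -> 0 <= M -> exp_bounded M kappa U ->
  coercive_on_half_plane (diff_quotient_lim U) (omega + r / 4) r ->
  diff_quotient_lim U u y -> 0 < a ->
  (forall s, continuous f0 s) -> RInt f0 0 a = 1 ->
  slow_energy_growth U r a u (omega + r / 4) -> slow_energy_growth U r a u omega.
Proof.
  intros HU Hr HM HUM Hco Huy Ha Hf0 Hf0a Hslow.
  pose proof (damped_tail_energy_bound H U (omega + r / 4) r M kappa a f0 u y HU Hr HM HUM Hco
    Huy Ha Hf0 Hf0a Hslow) as I.
  set (g' := orbit_sqr (damped (omega + r / 4) U) u) in *.
  set (K := RInt (fun s => f0 s ^ 2 * g' s) 0 a) in *.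
  assert (Hg : forall s, continuous (orbit_sqr (damped omega U) u) s)
    by apply orbit_sqr_continuous, damped_semigroup, HU.
  assert (Hg' : forall s, continuous g' s)
    by apply orbit_sqr_continuous, damped_semigroup, HU.
  exists (K / r ^ 2). intros T HT. specialize (I T HT).
  assert (Hr2 : 0 < r ^ 2) by (apply pow_lt; exact Hr).
  apply Rle_trans with (RInt (fun s => exp (r * T / 2) * g' s) a T).
  - apply RInt_le; [exact HT | apply ex_RInt_cont, Hg | |].
    { apply ex_RInt_cont. intros s.
      apply (continuous_mult (fun _ => exp (r * T / 2)) g'); [apply continuous_const | apply Hg']. }
    intros s Hs. unfold g'. rewrite !orbit_sqr_damped, <- Rmult_assoc, <- exp_plus by lra.
    apply Rmult_le_compat_r; [apply orbit_sqr_ge_0|]. apply exp_monotone. nra.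
  - rewrite RInt_scal_R by (apply ex_RInt_cont, Hg').
    rewrite Rmult_comm. apply Rmult_le_compat_r; [left; apply exp_pos|].
    apply Rmult_le_reg_l with (r ^ 2); [exact Hr2|].
    apply Rle_trans with (1 := I). right.
    assert (E : forall c : R, c = r ^ 2 * (c / r ^ 2)) by (intros; field; lra). apply E.
Qed.

Lemma slow_energy_growth_at_abscissa (H : HilbertSpace) (U : R -> H -> H)
    (omega r M kappa a : R) (f0 : R -> R) (u y : H) :
  is_C0_semigroup U -> 0 < r -> 0 <= M -> exp_bounded M kappa U ->
  coercive_on_half_plane (diff_quotient_lim U) omega r ->
  diff_quotient_lim U u y -> 0 < a ->
  (forall s, continuous f0 s) -> RInt f0 0 a = 1 ->
  slow_energy_growth U r a u omega.
Proof.
  intros HU Hr HM HUM Hco Huy Ha Hf0 Hf0a.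
  assert (Down : forall n, slow_energy_growth U r a u (omega + INR n * (r / 4)) ->
                 slow_energy_growth U r a u omega).
  { induction n as [|n IH].
    - simpl. rewrite Rmult_0_l, Rplus_0_r. intros Hn; exact Hn.
    - intros Hn. apply IH.
      apply (slow_energy_growth_step H U _ r M kappa a f0 u y); try assumption.
      + apply (coercive_half_plane_le H _ omega); [|exact Hco].
        pose proof (pos_INR n). nra.
      + rewrite S_INR in Hn.
        replace (omega + INR n * (r / 4) + r / 4) with (omega + (INR n + 1) * (r / 4)) by ring.
        exact Hn. }
  (* Enough steps of length [r / 4] to climb from [omega] above [kappa]. *)
  destruct (INR_unbounded ((kappa - omega) / (r / 4))) as [n Hn].
  apply (Down n).
  apply (slow_energy_growth_init H U _ r M kappa a u); try assumption.
  assert (kappa - omega < INR n * (r / 4)).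
  { apply Rle_lt_trans with ((kappa - omega) / (r / 4) * (r / 4)).
    - right. field. lra.
    - apply Rmult_lt_compat_r; lra. }
  lra.
Qed.

(** An interval of length at most [n] is covered by [n] steps of length at most 1; the
    hypothesis [1 <= M] makes [M ^ n] nondecreasing in [n]. *)
Lemma exp_bounded_of_bounded_01 (H : HilbertSpace) (U : R -> H -> H) (M : R) :
  is_C0_semigroup U -> 1 <= M -> (forall t v, 0 <= t <= 1 -> norm (U t v) <= M * norm v) ->
  exp_bounded M (ln M) U.
Proof.
  intros HU HM Hb.
  assert (Hn : forall n t v, 0 <= t <= INR n -> norm (U t v) <= M ^ n * norm v).
  { induction n as [|n IH]; intros t v Ht.
    - simpl in Ht. replace t with 0 by lra. rewrite (semigroup_0 U HU). simpl. lra.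
    - rewrite S_INR in Ht. pose proof (norm_ge_0 v).
      assert (1 <= M ^ n) by (apply pow_R1_Rle; exact HM).
      destruct (Rle_dec t 1) as [Ht1|Ht1].
      + apply Rle_trans with (1 := Hb t v ltac:(lra)).
        apply Rmult_le_compat_r; [assumption|]. simpl. nra.
      + replace t with (1 + (t - 1)) by ring.
        rewrite (semigroup_plus U HU) by lra.
        apply Rle_trans with (1 := Hb 1 _ ltac:(lra)). simpl. rewrite Rmult_assoc.
        apply Rmult_le_compat_l; [lra|]. apply IH. lra. }
  intros t v Ht.
  destruct (nfloor_ex t Ht) as [n Hnt].
  apply Rle_trans with (1 := Hn (Datatypes.S n) t v ltac:(rewrite S_INR; lra)).
  apply Rmult_le_compat_r; [apply norm_ge_0|].
  simpl. apply Rmult_le_compat_l; [lra|].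
  rewrite <- (exp_ln (M ^ n)) by (apply pow_lt; lra).
  rewrite ln_pow by lra. apply exp_monotone.
  assert (0 <= ln M) by (rewrite <- ln_1; apply ln_le; lra). nra.
Qed.

(** * Density of the domain of the generator *)

Definition real_scal {H : HilbertSpace} (a : R) (x : H) : H := scal (RtoC a) x.

Lemma real_scal_assoc (H : HilbertSpace) (a b : R) (x : H) :
  real_scal a (real_scal b x) = real_scal (a * b) x.
Proof. unfold real_scal. rewrite RtoC_mult. exact (scal_assoc (RtoC a : C_Ring) (RtoC b) x). Qed.

Lemma real_scal_one (H : HilbertSpace) (x : H) : real_scal 1 x = x.
Proof. exact (scal_one x). Qed.

Lemma real_scal_distr_l (H : HilbertSpace) (a : R) (x y : H) :
  real_scal a (plus x y) = plus (real_scal a x) (real_scal a y).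
Proof. exact (scal_distr_l (RtoC a : C_Ring) x y). Qed.

Lemma real_scal_distr_r (H : HilbertSpace) (a b : R) (x : H) :
  real_scal (a + b) x = plus (real_scal a x) (real_scal b x).
Proof. unfold real_scal. rewrite RtoC_plus. exact (scal_distr_r (RtoC a : C_Ring) (RtoC b) x). Qed.

Lemma norm_real_scal_le (H : HilbertSpace) (a : R) (x : H) :
  norm (real_scal a x) <= Rabs a * norm x.
Proof. unfold real_scal. rewrite norm_scal_eq, Cmod_R. apply Rle_refl. Qed.

Definition real_module_class (H : HilbertSpace) : ModuleSpace.class_of R_Ring H :=
  ModuleSpace.Class R_Ring H (AbelianGroup.class H)
    (ModuleSpace.Mixin R_Ring (AbelianGroup.Pack H (AbelianGroup.class H) H) real_scal
       (real_scal_assoc H) (real_scal_one H) (real_scal_distr_l H) (real_scal_distr_r H)).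

Definition real_aux_class (H : HilbertSpace) : NormedModuleAux.class_of R_AbsRing H :=
  NormedModuleAux.Class R_AbsRing H (real_module_class H) (UniformSpace.class H).

Definition real_normed_class (H : HilbertSpace) : NormedModule.class_of R_AbsRing H :=
  NormedModule.Class R_AbsRing H (real_aux_class H)
    (NormedModule.Mixin R_AbsRing (NormedModuleAux.Pack R_AbsRing H (real_aux_class H) H)
       (fun x : H => norm x) (@norm_factor C_AbsRing H)
       (@norm_triangle C_AbsRing H) (norm_real_scal_le H)
       (@norm_compat1 C_AbsRing H) (@norm_compat2 C_AbsRing H) (@norm_eq_zero C_AbsRing H)).

(** The Hilbert space with scalars restricted to the real numbers, in which functions
    of a real variable can be integrated. Points, norm and uniform structure are
    unchanged, so continuity and limits mean the same in both spaces. *)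
Definition real_form (H : HilbertSpace) : CompleteNormedModule R_AbsRing :=
  CompleteNormedModule.Pack R_AbsRing H
    (CompleteNormedModule.Class R_AbsRing H (real_normed_class H)
       (CompleteNormedModule.mixin _ _ (CompleteNormedModule.class C_AbsRing H))) H.

Definition vRInt {H : HilbertSpace} (c : R -> H) (a b : R) : H :=
  RInt (V := real_form H) c a b.

Lemma vRInt_correct (H : HilbertSpace) (c : R -> H) (a b : R) :
  (forall s, continuous c s) -> is_RInt (V := real_form H) c a b (vRInt c a b).
Proof.
  intros Hc. apply (RInt_correct (V := real_form H)).
  apply (ex_RInt_continuous (V := real_form H)). intros s _. exact (Hc s).
Qed.

Lemma is_RInt_linear (H : HilbertSpace) (T : H -> H) (c : R -> H) (a b : R) (v : H) :
  is_linear T -> is_RInt (V := real_form H) c a b v ->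
  is_RInt (V := real_form H) (fun s => T (c s)) a b (T v).
Proof.
  intros HT Hc. unfold is_RInt in *.
  assert (HR : forall ptd, T (Riemann_sum (V := real_form H) c ptd) =
                           Riemann_sum (V := real_form H) (fun s => T (c s)) ptd).
  { apply SF_cons_ind.
    - intros x. exact (linear_map_zero H T HT).
    - intros x ptd IH. rewrite !Riemann_sum_cons. rewrite <- IH.
      etransitivity; [exact (linear_plus T HT _ _)|].
      apply (f_equal (fun z => plus z _)). exact (linear_scal T HT _ _). }
  apply filterlim_ext with
    (fun ptd => T (@scal _ (real_form H) (sign (b - a)) (Riemann_sum (V := real_form H) c ptd))).
  { intros ptd. rewrite <- HR. exact (linear_scal T HT _ _). }
  eapply filterlim_comp; [exact Hc|]. exact (linear_cont T v HT).
Qed.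

Lemma average_at_right (H : HilbertSpace) (c : R -> H) (b : R) :
  (forall s, continuous c s) ->
  filterlim (fun k => scal (RtoC (/ k)) (vRInt c b (b + k))) (at_right 0) (locally (c b)).
Proof.
  intros Hc P HP. destruct (locally_norm_le_locally (c b) P HP) as [eps Heps].
  destruct (Hc b _ (locally_ball_norm (c b) (pos_div_2 eps))) as [d Hd].
  exists d. intros k Hk Hpos.
  change (Rabs (k - 0) < d) in Hk. rewrite Rminus_0_r, Rabs_right in Hk by lra.
  apply Heps. change (norm (minus (scal (RtoC (/ k)) (vRInt c b (b + k))) (c b) : H) < eps).
  assert (I : norm (minus (vRInt c b (b + k)) (scal (RtoC k) (c b)) : H) <= k * (eps / 2)).
  { replace k with (b + k - b) at 3 by ring.
    apply (norm_RInt_le_const (V := real_form H) (fun s => minus (c s) (c b)) b (b + k)).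
    - lra.
    - intros s Hs. left. apply (Hd s). change (Rabs (s - b) < d).
      rewrite Rabs_right; lra.
    - apply (is_RInt_minus (V := real_form H)); [apply vRInt_correct, Hc|].
      replace (scal (RtoC k) (c b)) with (@scal _ (real_form H) (b + k - b) (c b)).
      + apply (is_RInt_const (V := real_form H)).
      + change (scal (RtoC (b + k - b)) (c b) = scal (RtoC k) (c b)). f_equal. f_equal. ring. }
  replace (minus (scal (RtoC (/ k)) (vRInt c b (b + k))) (c b))
    with (scal (RtoC (/ k)) (minus (vRInt c b (b + k)) (scal (RtoC k) (c b)))).
  - rewrite norm_scal_eq, Cmod_R, Rabs_right
      by (apply Rle_ge; left; apply Rinv_0_lt_compat; exact Hpos).
    apply Rle_lt_trans with (/ k * (k * (eps / 2))).
    + apply Rmult_le_compat_l; [left; apply Rinv_0_lt_compat; exact Hpos | exact I].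
    + replace (/ k * (k * (eps / 2))) with (eps / 2) by (field; lra).
      pose proof (cond_pos eps). lra.
  - rewrite RtoC_inv by lra. vec_coefs; [ring|]. field.
    intros E. apply (Rgt_not_eq _ _ Hpos). exact (RtoC_inj _ _ E).
Qed.

(** [U k] shifts the window of integration from [0, h] to [k, k + h]; after
    cancellation only the two windows of length [k] at [h] and at [0] remain. *)
Lemma diff_quotient_lim_average (H : HilbertSpace) (U : R -> H -> H) (x : H) (h : R) :
  is_C0_semigroup U -> 0 < h ->
  diff_quotient_lim U (vRInt (fun s => U (Rmax 0 s) x) 0 h) (minus (U h x) x).
Proof.
  intros HU Hh. set (c := fun s => U (Rmax 0 s) x).
  assert (Hc : forall s, continuous c s)
    by (apply (continuous_Rmax_0 _ (fun t => U t x)), (semigroup_cont U HU)).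
  assert (ch : c h = U h x) by (unfold c; rewrite Rmax_right by lra; reflexivity).
  assert (c0 : c 0 = x) by (unfold c; rewrite Rmax_right by lra; apply (semigroup_0 U HU)).
  rewrite <- ch. rewrite <- c0 at 1. unfold diff_quotient_lim.
  apply filterlim_ext_loc with
    (fun k => minus (scal (RtoC (/ k)) (vRInt c h (h + k)))
                    (scal (RtoC (/ k)) (vRInt c 0 (0 + k)))).
  - exists (mkposreal 1 Rlt_0_1). intros k _ Hk.
    assert (Ex : forall a b, ex_RInt (V := real_form H) c a b).
    { intros a b. eexists. apply vRInt_correct, Hc. }
    assert (E1 : U k (vRInt c 0 h) = vRInt c k (h + k)).
    { transitivity (vRInt (fun s => U k (c s)) 0 h).
      - symmetry. apply (is_RInt_unique (V := real_form H)).
        apply is_RInt_linear; [apply (semigroup_bounded U HU); lra | apply vRInt_correct, Hc].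
      - transitivity (vRInt (fun s => @scal _ (real_form H) 1 (c (1 * s + k))) 0 h).
        + apply (RInt_ext (V := real_form H)). intros s. rewrite Rmin_left, Rmax_right by lra.
          intros Hs. etransitivity; [|symmetry; exact (scal_one (V := real_form H) _)].
          unfold c. rewrite !Rmax_right by lra. rewrite Rmult_1_l, Rplus_comm.
          symmetry. apply (semigroup_plus U HU); lra.
        + etransitivity; [apply (RInt_comp_lin (V := real_form H) c 1 k 0 h), Ex|].
          unfold vRInt. f_equal; ring. }
    rewrite E1.
    assert (C1 : plus (vRInt c 0 k) (vRInt c k (h + k)) = vRInt c 0 (h + k))
      by exact (RInt_Chasles (V := real_form H) c _ _ _ (Ex _ _) (Ex _ _)).
    assert (C2 : plus (vRInt c 0 h) (vRInt c h (h + k)) = vRInt c 0 (h + k))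
      by exact (RInt_Chasles (V := real_form H) c _ _ _ (Ex _ _) (Ex _ _)).
    rewrite Rplus_0_l.
    transitivity (scal (RtoC (/ k))
      (minus (minus (plus (vRInt c 0 h) (vRInt c h (h + k))) (vRInt c 0 h)) (vRInt c 0 k))).
    { vec_coefs; ring. }
    rewrite C2, <- C1. vec_coefs; ring.
  - eapply filterlim_comp_2;
      [apply average_at_right, Hc | apply average_at_right, Hc |].
    eapply (filterlim_comp_2 (fun z => fst z) (fun z => opp (snd z)) plus).
    + apply filterlim_fst.
    + eapply filterlim_comp; [apply filterlim_snd | apply (filterlim_opp (c 0))].
    + apply (filterlim_plus (c h) (opp (c 0))).
Qed.

(** The averages of an orbit over [0, h] lie in the domain and tend to its starting
    point. *)
Lemma generator_domain_dense (H : HilbertSpace) (U : R -> H -> H) (x : H) (eps : R) :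
  is_C0_semigroup U -> 0 < eps ->
  exists u y, diff_quotient_lim U u y /\ norm (minus u x) < eps.
Proof.
  intros HU He. set (c := fun s => U (Rmax 0 s) x).
  assert (Hc : forall s, continuous c s)
    by (apply (continuous_Rmax_0 _ (fun t => U t x)), (semigroup_cont U HU)).
  assert (c0 : c 0 = x) by (unfold c; rewrite Rmax_right by lra; apply (semigroup_0 U HU)).
  destruct (average_at_right H c 0 Hc _ (locally_ball_norm (c 0) (mkposreal eps He))) as [d Hd].
  assert (Hh : 0 < d / 2) by (pose proof (cond_pos d); lra).
  set (h := d / 2) in *.
  exists (scal (RtoC (/ h)) (vRInt c 0 h)). eexists. split.
  - apply (diff_quotient_lim_linear H U HU). apply diff_quotient_lim_average; assumption.
  - rewrite <- c0. rewrite <- (Rplus_0_l h) at 2. apply Hd; [|exact Hh].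
    change (Rabs (h - 0) < d). rewrite Rminus_0_r, Rabs_right by lra. unfold h in *. lra.
Qed.

(** The majorant is bounded on [0, 1] by continuity. *)
Lemma exp_bounded_of_majorant (H : HilbertSpace) (U : R -> H -> H) (m : R -> R) :
  is_C0_semigroup U -> continuous_on (fun t => 0 <= t) m ->
  (forall t v, 0 <= t -> norm (U t v) <= m t * norm v) ->
  exists M kappa, 0 <= M /\ exp_bounded M kappa U.
Proof.
  intros HU Hm HUm.
  destruct (continuity_ab_maj (fun s => m (Rmax 0 s)) 0 1 Rle_0_1) as [s0 [Hs0 _]].
  { intros s _. apply continuity_pt_filterlim. apply (continuous_Rmax_0 _ m Hm s). }
  exists (Rmax 1 (m (Rmax 0 s0))), (ln (Rmax 1 (m (Rmax 0 s0)))).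
  assert (H1 : 1 <= Rmax 1 (m (Rmax 0 s0))) by apply Rmax_l.
  split; [lra|]. apply exp_bounded_of_bounded_01; [exact HU | exact H1 |].
  intros t v Ht. apply Rle_trans with (1 := HUm t v (proj1 Ht)).
  apply Rmult_le_compat_r; [apply norm_ge_0|].
  pose proof (Hs0 t Ht) as I. cbv beta in I. rewrite (Rmax_right 0 t) in I by lra.
  apply Rle_trans with (1 := I), Rmax_r.
Qed.

(** * The growth bound *)

Definition inverse_weight (omega : R) (m : R -> R) (s : R) : R :=
  exp (2 * omega * s) * (/ m (Rmax 0 s)) ^ 2.

Lemma inverse_weight_continuous (omega : R) (m : R -> R) :
  continuous_on (fun t => 0 <= t) m -> (forall t, 0 <= t -> 0 < m t) ->
  forall s, continuous (inverse_weight omega m) s.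
Proof.
  intros Hm Hpos s.
  apply (continuous_mult (fun s => exp (2 * omega * s)) (fun s => (/ m (Rmax 0 s)) ^ 2)).
  - apply continuous_comp; [|apply continuous_exp].
    apply (continuous_mult (fun _ => 2 * omega) (fun s => s));
      [apply continuous_const | apply continuous_id].
  - apply continuous_sqr.
    apply (continuous_comp (fun s => m (Rmax 0 s)) Rinv); [apply (continuous_Rmax_0 _ m Hm s)|].
    apply continuous_Rinv. apply Rgt_not_eq, Hpos, Rmax_l.
Qed.

Lemma inverse_weight_pos (omega : R) (m : R -> R) (s : R) :
  (forall t, 0 <= t -> 0 < m t) -> 0 < inverse_weight omega m s.
Proof.
  intros Hpos. apply Rmult_lt_0_compat; [apply exp_pos|].
  apply pow_lt, Rinv_0_lt_compat, Hpos, Rmax_l.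
Qed.

Lemma weighted_L2_norm_inverse (omega b : R) (m : R -> R) :
  0 <= b ->
  weighted_L2_norm omega b (fun s => 1 / m s) = sqrt (RInt (inverse_weight omega m) 0 b).
Proof.
  intros Hb. unfold weighted_L2_norm. f_equal. apply RInt_ext_R; [exact Hb|].
  intros s Hs. unfold inverse_weight. rewrite Rmax_right by lra.
  rewrite pow2_abs. unfold Rdiv. rewrite Rmult_1_l. reflexivity.
Qed.

(** The tail estimate with [f0] equal to [inverse_weight] divided by its integral over
    [0, a], the minimizer of the integral of [f0^2 e^{-2 omega s} m^2] among functions
    of integral 1. *)
Lemma orbit_bound_on_domain (H : HilbertSpace) (U : R -> H -> H) (omega r a a' : R) (m : R -> R)
    (u y : H) :
  is_C0_semigroup U -> 0 < r -> 0 < a -> 0 < a' ->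
  coercive_on_half_plane (diff_quotient_lim U) omega r ->
  continuous_on (fun t => 0 <= t) m -> (forall t, 0 <= t -> 0 < m t) ->
  (forall t v, 0 <= t -> norm (U t v) <= m t * norm v) ->
  diff_quotient_lim U u y ->
  r ^ 2 * RInt (inverse_weight omega m) 0 a * RInt (inverse_weight omega m) 0 a'
    * norm (U (a + a') u) ^ 2 <= exp (2 * omega * (a + a')) * norm u ^ 2.
Proof.
  intros HU Hr Ha Ha' Hco Hm Hpos HUm Huy.
  set (w := inverse_weight omega m).
  assert (Hw : forall s, continuous w s) by (apply inverse_weight_continuous; assumption).
  assert (Hw0 : forall s, 0 < w s) by (intros; apply inverse_weight_pos; assumption).
  set (Ia := (RInt w 0 a : R)). set (Ia' := (RInt w 0 a' : R)). set (t := a + a').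
  assert (HIa : 0 < Ia) by (apply RInt_gt_0; [exact Ha | intros; apply Hw0 | intros; apply Hw]).
  destruct (exp_bounded_of_majorant H U m HU Hm HUm) as [M [kappa [HM HUM]]].
  set (f0 := fun s => / Ia * w s).
  assert (Hf0 : forall s, continuous f0 s).
  { intros s. apply (continuous_mult (fun _ => / Ia) w); [apply continuous_const | apply Hw]. }
  assert (Hf0a : RInt f0 0 a = 1).
  { unfold f0. rewrite RInt_scal_R by (apply ex_RInt_cont, Hw).
    exact (Rinv_l Ia (Rgt_not_eq _ _ HIa)). }
  pose proof (damped_tail_energy_bound H U omega r M kappa a f0 u y HU Hr HM HUM Hco Huy Ha
    Hf0 Hf0a (slow_energy_growth_at_abscissa H U omega r M kappa a f0 u y HU Hr HM HUM Hco Huy Ha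
    Hf0 Hf0a) t ltac:(unfold t; lra)) as I.
  set (g := orbit_sqr (damped omega U) u) in *.
  assert (Hg : forall s, continuous g s)
    by apply orbit_sqr_continuous, damped_semigroup, HU.
  assert (Eg : forall s, 0 <= s -> g s = exp (- 2 * omega * s) * norm (U s u) ^ 2).
  { intros s Hs. unfold g. rewrite orbit_sqr_damped by exact Hs.
    unfold orbit_sqr. rewrite Rmax_right by exact Hs. reflexivity. }
  assert (Ew : forall s, 0 <= s -> w s * m s ^ 2 = exp (2 * omega * s)).
  { intros s Hs. unfold w, inverse_weight. rewrite Rmax_right by exact Hs.
    field. apply Rgt_not_eq, Hpos, Hs. }
  assert (Eexp : forall s, exp (2 * omega * s) * exp (- 2 * omega * s) = 1).
  { intros s. rewrite <- exp_plus, <- exp_0. f_equal. ring. }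
  assert (Up : RInt (fun s => f0 s ^ 2 * g s) 0 a <= / Ia * norm u ^ 2).
  { replace (/ Ia * norm u ^ 2) with (RInt (fun s => ((/ Ia) ^ 2 * norm u ^ 2) * w s) 0 a).
    2: { rewrite RInt_scal_R by (apply ex_RInt_cont, Hw). fold Ia.
         assert (E : forall c, c <> 0 -> (/ c) ^ 2 * norm u ^ 2 * c = / c * norm u ^ 2)
           by (intros; field; assumption).
         apply E, Rgt_not_eq, HIa. }
    apply RInt_le; [lra | | |].
    - apply ex_RInt_cont. intros s.
      apply (continuous_mult (fun s => f0 s ^ 2) g); [apply continuous_sqr, Hf0 | apply Hg].
    - apply ex_RInt_cont. intros s.
      apply (continuous_mult (fun _ => (/ Ia) ^ 2 * norm u ^ 2) w); [apply continuous_const | apply Hw].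
    - intros s Hs. rewrite Eg by lra. unfold f0.
      assert (J : norm (U s u) ^ 2 <= m s ^ 2 * norm u ^ 2).
      { rewrite <- Rpow_mult_distr. apply pow_incr. split; [apply norm_ge_0 | apply HUm; lra]. }
      apply Rle_trans with ((/ Ia * w s) ^ 2 * (exp (- 2 * omega * s) * (m s ^ 2 * norm u ^ 2))).
      + apply Rmult_le_compat_l; [apply pow2_ge_0|].
        apply Rmult_le_compat_l; [left; apply exp_pos | exact J].
      + right.
        transitivity ((/ Ia) ^ 2 * norm u ^ 2 * w s * ((w s * m s ^ 2) * exp (- 2 * omega * s)));
          [ring|].
        rewrite Ew, Eexp by lra. ring. }
  assert (Low : exp (- 2 * omega * t) * norm (U t u) ^ 2 * Ia' <= RInt g a t).
  { assert (Crev : forall s, continuous (fun s => w (-1 * s + t)) s).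
    { intros s. apply (continuous_comp (fun s => -1 * s + t) w); [|apply Hw].
      apply (continuous_plus (fun s => -1 * s) (fun _ => t)); [|apply continuous_const].
      apply (continuous_mult (fun _ => -1) (fun s => s)); [apply continuous_const | apply continuous_id]. }
    assert (Erev : (RInt (fun s => w (-1 * s + t)) a t : R) = Ia').
    { pose proof (RInt_comp_lin (V := R_CompleteNormedModule) w (-1) t a t
        (ex_RInt_cont w _ _ Hw)) as E.
      change (RInt (fun s => -1 * w (-1 * s + t)) a t = RInt w (-1 * a + t) (-1 * t + t)) in E.
      rewrite RInt_scal_R in E by (apply ex_RInt_cont, Crev).
      replace (-1 * a + t) with a' in E by (unfold t; ring).
      replace (-1 * t + t) with 0 in E by ring.
      assert (Esw : opp (RInt w 0 a') = RInt w a' 0)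
        by exact (opp_RInt_swap w 0 a' (ex_RInt_cont w _ _ Hw)).
      rewrite <- Esw in E. change (-1 * RInt (fun s => w (-1 * s + t)) a t = - Ia') in E. lra. }
    rewrite <- Erev, <- RInt_scal_R by (apply ex_RInt_cont, Crev).
    apply RInt_le; [unfold t; lra | | apply ex_RInt_cont, Hg |].
    - apply ex_RInt_cont. intros s.
      apply (continuous_mult (fun _ => exp (- 2 * omega * t) * norm (U t u) ^ 2)
               (fun s => w (-1 * s + t))); [apply continuous_const | apply Crev].
    - intros s Hs. rewrite Eg by lra.
      set (q := -1 * s + t). assert (Hq : 0 <= q) by (unfold q; lra).
      assert (J : norm (U t u) ^ 2 <= m q ^ 2 * norm (U s u) ^ 2).
      { rewrite <- Rpow_mult_distr. apply pow_incr. split; [apply norm_ge_0|].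
        replace t with (q + s) by (unfold q; ring).
        rewrite (semigroup_plus U HU) by lra. apply HUm, Hq. }
      apply Rle_trans with (exp (- 2 * omega * t) * (m q ^ 2 * norm (U s u) ^ 2) * w q).
      + apply Rmult_le_compat_r; [left; apply Hw0|].
        apply Rmult_le_compat_l; [left; apply exp_pos | exact J].
      + right.
        transitivity (exp (- 2 * omega * t) * (w q * m q ^ 2) * norm (U s u) ^ 2); [ring|].
        rewrite Ew, <- exp_plus by exact Hq. f_equal. f_equal. unfold q. ring. }
  assert (Hr2 : 0 < r ^ 2) by (apply pow_lt; exact Hr).
  assert (I' : r ^ 2 * (exp (- 2 * omega * t) * norm (U t u) ^ 2 * Ia') <= / Ia * norm u ^ 2).
  { apply Rle_trans with (2 := Up), Rle_trans with (2 := I).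
    apply Rmult_le_compat_l; [lra | exact Low]. }
  replace (r ^ 2 * Ia * Ia' * norm (U t u) ^ 2)
    with (exp (2 * omega * t) * Ia * (r ^ 2 * (exp (- 2 * omega * t) * norm (U t u) ^ 2 * Ia'))).
  2: { transitivity ((exp (2 * omega * t) * exp (- 2 * omega * t))
         * (r ^ 2 * Ia * Ia' * norm (U t u) ^ 2)); [ring|]. rewrite Eexp. ring. }
  replace (exp (2 * omega * t) * norm u ^ 2)
    with (exp (2 * omega * t) * Ia * (/ Ia * norm u ^ 2)) by (field; lra).
  apply Rmult_le_compat_l; [|exact I'].
  apply Rmult_le_pos; [left; apply exp_pos | lra].
Qed.

Lemma norm_bound_from_dense (H : HilbertSpace) (T : H -> H) (D : H -> Prop) (K : R) :
  is_linear T -> 0 <= K ->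
  (forall x eps, 0 < eps -> exists u, D u /\ norm (minus u x) < eps) ->
  (forall u, D u -> norm (T u) <= K * norm u) ->
  forall x, norm (T x) <= K * norm x.
Proof.
  intros HT HK Hdense HD x.
  pose proof (op_norm_ge_0 H T HT) as HT0.
  apply Rle_plus_epsilon. intros eps He.
  assert (Hd : 0 < eps / (K + op_norm T + 1)) by (apply Rdiv_lt_0_compat; lra).
  set (d := eps / (K + op_norm T + 1)) in *.
  assert (Ed : d * (K + op_norm T + 1) = eps) by (unfold d; field; lra).
  destruct (Hdense x d Hd) as [u [Hu Hux]].
  assert (N1 : norm (T x) <= norm (T u) + norm (T (minus u x))).
  { replace (T x) with (minus (T u) (T (minus u x))).
    - apply norm_minus_le.
    - assert (E : T (minus u x) = minus (T u) (T x)) by exact (linear_minus T u x HT).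
      rewrite E. vec_coefs; ring. }
  assert (N2 : norm u <= norm x + norm (minus u x)).
  { replace u with (plus x (minus u x)) at 1 by (vec_coefs; ring).
    exact (norm_triangle x (minus u x)). }
  pose proof (HD u Hu). pose proof (norm_apply_le H T (minus u x) HT).
  pose proof (norm_ge_0 (minus u x)).
  assert (K * norm u <= K * (norm x + norm (minus u x))) by (apply Rmult_le_compat_l; assumption).
  set (n := norm (minus u x)) in *.
  assert (K * n <= K * d) by (apply Rmult_le_compat_l; lra).
  assert (op_norm T * n <= op_norm T * d) by (apply Rmult_le_compat_l; lra).
  lra.
Qed.

Theorem theorem1p5
  (H : HilbertSpace) (S : R -> H -> H) (A : operator H) (omega r : R) (m : R -> R)
  (hS : is_C0_semigroup S)
  (hA : is_generator S A)
  (hbounded : resolvent_bounded_on_half_plane A omega)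
  (hr : 0 < r)
  (hsup : is_lub (resolvent_norms A omega) (1 / r))
  (hm_pos : forall t : R, 0 <= t -> 0 < m t)
  (hm_cont : continuous_on (fun t : R => 0 <= t) m)
  (hm : forall t : R, 0 <= t -> op_norm (S t) <= m t)
  (t a a' : R) (ht : 0 < t) (ha : 0 < a) (ha' : 0 < a') (htaa' : t = a + a') :
  op_norm (S t) <=
    exp (omega * t) /
      (r * weighted_L2_norm omega a (fun s : R => 1 / m s)
         * weighted_L2_norm omega a' (fun s : R => 1 / m s)).
Proof.
  pose proof (resolvent_coercive H S A omega r hA hbounded hr hsup) as Hco.
  assert (Hlin : is_linear (S t)) by (apply (semigroup_bounded S hS); lra).
  assert (HUm : forall t v, 0 <= t -> norm (S t v) <= m t * norm v).
  { intros s v Hs. apply Rle_trans with (1 := norm_apply_le H (S s) v (semigroup_bounded S hS s Hs)).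
    apply Rmult_le_compat_r; [apply norm_ge_0 | apply hm, Hs]. }
  assert (Hw : forall s, continuous (inverse_weight omega m) s)
    by (apply inverse_weight_continuous; assumption).
  rewrite !weighted_L2_norm_inverse by lra.
  set (Ia := (RInt (inverse_weight omega m) 0 a : R)).
  set (Ia' := (RInt (inverse_weight omega m) 0 a' : R)).
  assert (HIa : 0 < Ia).
  { apply RInt_gt_0; [exact ha | intros; apply inverse_weight_pos, hm_pos | intros; apply Hw]. }
  assert (HIa' : 0 < Ia').
  { apply RInt_gt_0; [exact ha' | intros; apply inverse_weight_pos, hm_pos | intros; apply Hw]. }
  pose proof (sqrt_lt_R0 _ HIa) as Hq. pose proof (sqrt_lt_R0 _ HIa') as Hq'.
  assert (HQ : 0 < r * sqrt Ia * sqrt Ia') by (repeat apply Rmult_lt_0_compat; assumption).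
  assert (HK : 0 <= exp (omega * t) / (r * sqrt Ia * sqrt Ia')).
  { left. apply Rdiv_lt_0_compat; [apply exp_pos | exact HQ]. }
  apply op_norm_le; [exact Hlin | exact HK |].
  apply (norm_bound_from_dense H (S t) (fun u => exists y, diff_quotient_lim S u y));
    [exact Hlin | exact HK | |].
  { intros x eps He. destruct (generator_domain_dense H S x eps hS He) as [u [y [Hu Hux]]].
    exists u. split; [exists y; exact Hu | exact Hux]. }
  intros u [y Huy].
  pose proof (orbit_bound_on_domain H S omega r a a' m u y hS hr ha ha' Hco hm_cont hm_pos HUm Huy)
    as I.
  rewrite <- htaa' in I. fold Ia Ia' in I.
  apply Rmult_le_reg_l with (r * sqrt Ia * sqrt Ia'); [exact HQ|].
  replace (r * sqrt Ia * sqrt Ia' * (exp (omega * t) / (r * sqrt Ia * sqrt Ia') * norm u))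
    with (exp (omega * t) * norm u) by (field; repeat split; lra).
  apply Rsqr_incr_0.
  - rewrite !Rsqr_pow2, !Rpow_mult_distr, !pow2_sqrt by lra.
    replace (exp (omega * t) ^ 2) with (exp (2 * omega * t)); [exact I|].
    simpl. rewrite Rmult_1_r, <- exp_plus. f_equal. ring.
  - apply Rmult_le_pos; [lra | apply norm_ge_0].
  - apply Rmult_le_pos; [left; apply exp_pos | apply norm_ge_0].
Qed.
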